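(* Let $\mathcal{H}$ be a non-central hyperplane arrangement in $\mathbb{R}^n$ with unbounded intersection lattice $\mathcal{L}_{ub}$ and poset of unbounded regions $T_{ub}$. Then $$\Psi(T_{ub})=\omega\big(\mathbf{a}\cdot\Psi(\mathcal{L}_{ub})\big)^*.$$
   Context: An essential hyperplane arrangement in $\mathbb{R}^n$ is a finite set of affine hyperplanes whose normals span $\mathbb{R}^n$; non-central means the intersection of all hyperplanes is empty. The intersection lattice $\mathcal{L}$ consists of all intersections of subsets of the hyperplanes, ordered by reverse inclusion, with minimum $\mathbb{R}^n$ and maximum $\emptyset$, graded of rank $n+1$ ($\rho(x)=n-\dim x$). $\mathcal{L}_{ub}$ is $\mathcal{L}$ with all points (its coatoms) removed, i.e. the rank-selected poset on ranks $1,\dots,n-1$ together with $\hat0,\hat1$. $T_{ub}$ is the face poset of the regular cell decomposition of a sphere obtained by intersecting the arrangement with a sphere of radius $R$ large enough that all bounded faces lie strictly inside the ball of radius $R$; equivalently the unbounded faces ordered by $F\le G$ iff $F\subseteq\overline G$, with a minimum and maximum adjoined. $\mathbf{a}\mathbf{b}$-index: for a graded poset $P$ of rank $r+1$ and $S\subseteq\{1,\dots,r\}$, $f_S$ counts chains $\hat0<x_1<\cdots<\hat1$ whose rank set is exactly $S$, $h_S=\sum_{T\subseteq S}(-1)^{|S-T|}f_T$, $\Psi(P)=\sum_Sh_Su_S\in\mathbb{Z}\langle\mathbf{a},\mathbf{b}\rangle$, $u_S=u_1\cdots u_r$, $u_i=\mathbf{b}$ if $i\in S$ else $\mathbf{a}$.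 $\omega$ is the linear map sending an $\mathbf{a}\mathbf{b}$-monomial to the $\mathbf{c}\mathbf{d}$-monomial obtained by replacing each occurrence of $\mathbf{a}\mathbf{b}$ by $2\mathbf{d}$ and every remaining letter by $\mathbf{c}$ ($\mathbf{c}=\mathbf{a}+\mathbf{b}$, $\mathbf{d}=\mathbf{a}\mathbf{b}+\mathbf{b}\mathbf{a}$). The involution $^*$ reverses each monomial, extended linearly. *)

(* Defs.v *)
From HB Require Import structures.
From mathcomp Require Import all_boot all_order all_algebra finmap.
From mathcomp Require Import all_classical all_reals.
From mathcomp Require Import topology normedtype.
From mathcomp.multinomials Require Import -(notations) monalg.

Set Implicit Arguments.
Unset Strict Implicit.
Unset Printing Implicit Defensive.

Import Order.TTheory GRing.Theory Num.Theory.
Import numFieldNormedType.Exports.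

Local Open Scope classical_set_scope.
Local Open Scope ring_scope.

(** * The ring Z<a,b>, the involution * and the map omega *)

(** The monoid ring of the free monoid on a (encoded by [false]) and b (encoded
    by [true]). *)
Definition abpoly := malg (fmonom bool) int.

Definition word (w : seq bool) : abpoly := mkmalgU (FMonom w) 1.

Definition pa : abpoly := word [:: false].
Definition pb : abpoly := word [:: true].
Definition pc : abpoly := pa + pb.
Definition pd : abpoly := pa * pb + pb * pa.

(** The linear extension of a map defined on words. *)
Definition linext (F : seq bool -> abpoly) (p : abpoly) : abpoly :=
  \sum_(w <- msupp p) mcoeff w p *: F w.

Definition star : abpoly -> abpoly := linext (fun w => word (rev w)).

(** Occurrences of ab in a word are disjoint, so they can be replaced from left
    to right; cd-polynomials are regarded as elements of Z<a,b>. *)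
Fixpoint omega_word (w : seq bool) : abpoly :=
  match w with
  | [::] => 1
  | false :: (true :: w') => (pd *+ 2) * omega_word w'
  | _ :: w' => pc * omega_word w'
  end.

Definition omega : abpoly -> abpoly := linext omega_word.

(** * The ab-index of a finite graded poset with minimum and maximum *)

Section ABIndex.
Variables (T : finType) (le : rel T).

Definition chain (C : {set T}) : bool :=
  [forall x in C, forall y in C, le x y || le y x].

(** The maximal length of a chain descending from [x]; on a graded poset this
    is the rank function. *)
Definition rank (x : T) : nat :=
  \max_(C : {set T} | chain C && [forall y in C, (y != x) && le y x]) #|C|.

(** The number r of proper ranks: the poset has rank r + 1. *)
Definition nranks : nat := (\max_(x : T) rank x).-1.

(** [S : {set 'I_r}] encodes the subset {i + 1 | i in S} of {1, ..., r}. *)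
Definition has_rank_set (C : {set T}) (S : {set 'I_nranks}) : bool :=
  [forall x in C, exists i in S, rank x == i.+1] &&
  [forall i in S, exists x in C, rank x == i.+1].

(** A chain 0 < x_1 < ... < x_k < 1 is recorded by the set {x_1, ..., x_k},
    which avoids 0 and 1 because their ranks are 0 and r + 1. *)
Definition flag_f (S : {set 'I_nranks}) : nat :=
  #|[set C : {set T} | chain C && has_rank_set C S]|.

Definition flag_h (S : {set 'I_nranks}) : int :=
  \sum_(U : {set 'I_nranks} | U \subset S)
     (-1) ^+ #|S :\: U| * (flag_f U)%:Z.

Definition Psi : abpoly :=
  \sum_(S : {set 'I_nranks})
     flag_h S *: word [seq i \in S | i <- enum 'I_nranks].

End ABIndex.

(** * Adjoining a minimum and a maximum to a poset *)

Definition hat (T : Type) : Type := (unit + T + unit)%type.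
HB.instance Definition _ (T : finType) := Finite.on (hat T).

(** [inl (inl tt)] is the new minimum and [inr tt] the new maximum. *)
Definition hat_le (T : Type) (le : rel T) : rel (hat T) := fun x y =>
  match x, y with
  | inl (inl _), _ => true
  | _, inr _ => true
  | inl (inr u), inl (inr v) => le u v
  | _, _ => false
  end.

(** * Affine hyperplane arrangements *)

Section Hyperplane.
Variables (R : realType) (n : nat).

Definition dot (u v : 'rV[R]_n) : R := \sum_(j < n) u 0 j * v 0 j.

Definition hyperplane (u : 'rV[R]_n) (b : R) : set 'rV[R]_n :=
  [set x | dot u x = b].

(** A finite set of affine hyperplanes, enumerated without repetition, each with
    a chosen equation. *)
Record arrangement := Arrangement {
  size_arr : nat;
  normal_vec : 'I_size_arr -> 'rV[R]_n;
  offset : 'I_size_arr -> R;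
  normal_vec_neq0 : forall i, normal_vec i != 0;
  hyperplane_inj : injective (fun i => hyperplane (normal_vec i) (offset i))
}.

End Hyperplane.

Section Arrangement.
Variables (R : realType) (n : nat) (A : arrangement R n).

Definition hyp (i : 'I_(size_arr A)) : set 'rV[R]_n :=
  hyperplane (normal_vec i) (offset i).

Definition essential : bool := row_full (\matrix_i normal_vec (a := A) i).

Definition noncentral : Prop := \bigcap_i hyp i = set0.

(** The intersection over the empty family is the whole space. *)
Definition intersection_lattice : set (set 'rV[R]_n) :=
  [set X | exists J : set 'I_(size_arr A), X = \bigcap_(i in J) hyp i].

Definition is_point (X : set 'rV[R]_n) : Prop := exists p, X = [set p].

(** [fset_set] turns a finite set (here, of subsets of the space) into the
    corresponding finite type. *)
Definition Lub : finType :=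
  fset_set [set X | intersection_lattice X /\ ~ is_point X].

Definition Lub_le : rel Lub := fun X Y => `[< val Y `<=` val X >].

(** The relatively open face containing [x]: the points lying on the same side
    as [x] of (or on, together with [x]) every hyperplane. *)
Definition face_of (x : 'rV[R]_n) : set 'rV[R]_n :=
  [set y | forall i : 'I_(size_arr A),
     Num.sg (dot (normal_vec i) y - offset i) =
     Num.sg (dot (normal_vec i) x - offset i)].

Definition unbounded_face : finType :=
  fset_set [set F | range face_of F /\ ~ bounded_set F].

Definition unbounded_face_le : rel unbounded_face :=
  fun F G => `[< val F `<=` closure (val G) >].

Definition Tub : finType := hat unbounded_face.

Definition Tub_le : rel Tub := hat_le unbounded_face_le.

End Arrangement.

(* Main.v *)
Require Import Defs.
From HB Require Import structures.
From mathcomp Require Import all_boot all_order all_algebra finmap zify ring lra.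
From mathcomp Require Import boolp reals.
From mathcomp.multinomials Require Import -(notations) monalg.

(** Write e = a - b and c = a + b. The ab-index of a poset is the sum over its
    chains of the words with letter b at the ranks occupied by the chain and e
    elsewhere. Peeling off the smallest element of a chain gives a recursion for
    the sums Phi(F) over chains of unbounded faces above a face F, and one for
    the analogous sums Xi(x) over chains of flats above a flat x, where flats
    are ordered by inclusion and the empty flat corresponds to the minimum of
    T_ub. The conjugate Om of omega by the involution satisfies
    Om(e e p) = e e Om(p) and Om(e b p) = 0, so only flats at odd distance
    contribute to Om(Xi(x)); solving for b Om(Xi(x)), one finds that Om(Xi)
    obeys the recursion of Phi as soon as
      sum_(G > F, G inside y) (-1)^dim G = (-1)^dim y - (-1)^dim F
    for every flat y containing F, the minimum counting as a face of dimension 0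
    inside every flat. These Euler relations follow by inserting the hyperplanes
    one at a time. For the minimum one also needs that the bounded cells inside
    a nonempty flat have alternating sum 1. Bounded is to mean there that the
    recession cone is the lineality space, and a cell is to be weighted by the
    parity of its dimension modulo its lineality space, so that the sum stays
    invariant even while the hyperplanes inserted so far are not essential. *)

Set Implicit Arguments.
Unset Strict Implicit.
Unset Printing Implicit Defensive.

Import Order.TTheory GRing.Theory Num.Theory.

Local Open Scope ring_scope.

(** * Words in a and b, and the map omega *)

(** Faces are ranked by dimension but flats by codimension, so [star] turns Psi(L_ub) into the
    ab-index of the flats ordered by inclusion, and the right-hand side becomes Om(star(Psi(L_ub))
    a). The trailing a = e + b supplies the rank of dimension n, where a chain of flats may or may
    not contain the whole space. Both sides thus live on the ranks 1, ..., n and are compared along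
    the map sending a face to its affine span. The recursion of Phi has the coefficient b, whereas
    Om is controlled through e and c; the link is 2b = c - e together with c Om(p) = Om(e p) + Om(b
    p). Hence the recursions are compared after doubling. In 2b Om(Xi(x)) every flat y above x
    carries the sign (-1)^(dim y - dim x), so that summing over faces leaves an alternating count of
    faces. Multiplied by (-1)^dim y, the right-hand side of the Euler relation is 2 at odd distance
    and 0 at even distance, which is the selection made by Om. *)

Lemma wordM (s t : seq bool) : word s * word t = word (s ++ t).
Proof.
rewrite /word malgM_def fgmulUU mulr1; congr mkmalgU.
by apply: val_inj; rewrite /= fmM.
Qed.

Lemma word0 : word [::] = 1.
Proof. by congr mkmalgU; apply: val_inj; rewrite /= fm1. Qed.

(** [linext] sums over the support of its argument; a common larger index set makes the sums for p,
    q and p - q comparable. *)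
Lemma linextEw (F : seq bool -> abpoly) (d : {fset fmonom bool}) (p : abpoly) :
  (msupp p `<=` d)%fset -> linext F p = \sum_(w <- d) mcoeff w p *: F w.
Proof.
move=> pd; rewrite /linext (big_fset_incl _ pd) // => w _ wp.
by rewrite mcoeff_outdom // scale0r.
Qed.

Lemma linext_is_additive (F : seq bool -> abpoly) : additive (linext F).
Proof.
move=> p q.
have hp : (msupp p `<=` msupp p `|` msupp q `|` msupp (p - q))%fset.
  by rewrite -fsetUA fsubsetUl.
have hq : (msupp q `<=` msupp p `|` msupp q `|` msupp (p - q))%fset.
  by rewrite (fsetUC (msupp p)) -fsetUA fsubsetUl.
have hpq : (msupp (p - q) `<=` msupp p `|` msupp q `|` msupp (p - q))%fset.
  by rewrite fsubsetUr.
rewrite (linextEw _ hp) (linextEw _ hq) (linextEw _ hpq) -sumrB.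
by apply: eq_bigr => w _; rewrite mcoeffB scalerBl.
Qed.

HB.instance Definition _ (F : seq bool -> abpoly) :=
  GRing.isZmodMorphism.Build abpoly abpoly (linext F) (linext_is_additive F).
HB.instance Definition _ := GRing.Additive.on star.
HB.instance Definition _ := GRing.Additive.on omega.

Lemma linext_word (F : seq bool -> abpoly) (w : seq bool) :
  linext F (word w) = F w.
Proof.
rewrite (@linextEw _ [fset FMonom w]%fset) ?msuppU_le // big_seq_fset1.
by rewrite mcoeffUU scale1r.
Qed.

Lemma abpoly_expand (p : abpoly) :
  p = \sum_(w <- msupp p) word w *~ mcoeff w p.
Proof.
rewrite {1}[p]monalgE; apply: eq_bigr => w _.
by rewrite /word -raddfMz /= intz fmK.
Qed.

Lemma additive_ext (f g : abpoly -> abpoly) : additive f -> additive g ->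
  (forall w, f (word w) = g (word w)) -> f =1 g.
Proof.
move=> fB gB fg p.
pose F : {additive abpoly -> abpoly} :=
  HB.pack f (GRing.isZmodMorphism.Build _ _ f fB).
pose G : {additive abpoly -> abpoly} :=
  HB.pack g (GRing.isZmodMorphism.Build _ _ g gB).
rewrite -[f p]/(F p) -[g p]/(G p) [p]abpoly_expand !raddf_sum.
by apply: eq_bigr => w _; rewrite !raddfMz /= fg.
Qed.

Lemma star_word (w : seq bool) : star (word w) = word (rev w).
Proof. exact: linext_word. Qed.

Lemma omega_wordE (w : seq bool) : omega (word w) = omega_word w.
Proof. exact: linext_word. Qed.

Lemma starK (p : abpoly) : star (star p) = p.
Proof.
apply: (@additive_ext (star \o star) idfun) => [q r|//|w] /=; first by rewrite !raddfB.
by rewrite !star_word revK.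
Qed.

Lemma starM (p q : abpoly) : star (p * q) = star q * star p.
Proof.
apply: (@additive_ext (fun p => star (p * q)) (fun p => star q * star p))
  => {p} [p p'|p p'|w].
- by rewrite mulrBl raddfB.
- by rewrite raddfB mulrBr.
apply: (@additive_ext (fun q => star (word w * q))
  (fun q => star q * star (word w))) => {q} [q q'|q q'|v].
- by rewrite mulrBr raddfB.
- by rewrite raddfB mulrBl.
by rewrite wordM !star_word wordM rev_cat.
Qed.

Lemma star1 : star 1 = 1.
Proof. by rewrite -word0 star_word. Qed.

Lemma star_prod (T : Type) (s : seq T) (F : T -> abpoly) :
  star (\prod_(i <- s) F i) = \prod_(i <- rev s) star (F i).
Proof.
elim: s => [|x s IHs]; first by rewrite !big_nil star1.
by rewrite rev_cons big_cons starM IHs -cats1 big_cat big_seq1.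
Qed.

Lemma star_pa : star pa = pa. Proof. exact: star_word. Qed.
Lemma star_pb : star pb = pb. Proof. exact: star_word. Qed.

Lemma starD : {morph star : p q / p + q}. Proof. exact: raddfD. Qed.
Lemma starMn n : {morph star : p / p *+ n}. Proof. exact: raddfMn. Qed.

Lemma star_pc : star pc = pc.
Proof. by rewrite starD star_pa star_pb. Qed.

Lemma antimorphism_fix (S : nzRingType) (f : S -> S) (p q : S) :
  {morph f : x y / x + y} -> (forall x y, f (x * y) = f y * f x) ->
  f p = p -> f q = q -> f (p * q + q * p) = p * q + q * p.
Proof. by move=> fD fM hp hq; rewrite fD !fM hp hq addrC. Qed.

Lemma star_pd : star pd = pd.
Proof. exact: (antimorphism_fix starD starM star_pa star_pb). Qed.

Section ReplaceWord.
Variables (S : nzRingType) (c d2 : S).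

Fixpoint replace_word (w : seq bool) : S :=
  match w with
  | [::] => 1
  | false :: (true :: w') => d2 * replace_word w'
  | _ :: w' => c * replace_word w'
  end.

(** [omega_word] parses from the left, while prefixing a letter to a reversed word appends it on the
    right. Occurrences of ab are disjoint, so parsing from the right gives the same product. In the
    third equation the last b follows another b and therefore counts alone. *)
Lemma replace_word_recr (w : seq bool) :
  [/\ replace_word (rcons w false) = replace_word w * c,
      replace_word (rcons (rcons w false) true) = replace_word w * d2
    & replace_word (rcons (rcons w true) true) =
        replace_word (rcons w true) * c].
Proof.
(* Strong induction on the length, since an occurrence of ab consumes two letters at once. *)
elim/ltn_ind: {w}(size w) {-2}w (erefl (size w)) => k IH [|x w] /= kE.
  by rewrite !mulr1 !mul1r.
have [h1 h2 h3] : [/\ replace_word (rcons w false) = replace_word w * c,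
    replace_word (rcons (rcons w false) true) = replace_word w * d2
  & replace_word (rcons (rcons w true) true) = replace_word (rcons w true) * c].
  by apply: (IH (size w)); rewrite -?kE.
case: x => /=; first by rewrite h1 h2 h3 !mulrA.
case: w kE h1 h2 h3 => [|[] w] /= kE h1 h2 h3.
- by rewrite !mulr1 ?mul1r; split.
- have [h1' h2' h3'] : [/\ replace_word (rcons w false) = replace_word w * c,
      replace_word (rcons (rcons w false) true) = replace_word w * d2
    & replace_word (rcons (rcons w true) true) =
        replace_word (rcons w true) * c].
    by apply: (IH (size w)); rewrite -?kE.
  by rewrite h1' h2' h3' !mulrA.
by rewrite h1 h2 h3 !mulrA.
Qed.

End ReplaceWord.

Lemma omega_word_replace (w : seq bool) :
  omega_word w = replace_word pc (pd *+ 2) w.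
Proof.
by [].
Qed.

(** Conjugation makes the pattern ba instead of ab, so that prefixing a letter becomes a left
    multiplication, as needed when chains are read from their smallest element. *)
Definition romega (p : abpoly) : abpoly := star (omega (star p)).

Lemma romega_is_additive : additive romega.
Proof. by move=> p q; rewrite /romega !raddfB. Qed.

HB.instance Definition _ :=
  GRing.isZmodMorphism.Build abpoly abpoly romega romega_is_additive.

Lemma romega_word (w : seq bool) :
  romega (word (rev w)) = star (replace_word pc (pd *+ 2) w).
Proof. by rewrite /romega star_word revK omega_wordE omega_word_replace. Qed.

Lemma romega1 : romega 1 = 1.
Proof. by rewrite -[X in romega X]word0 (romega_word [::]) star1. Qed.

Lemma romega_b : romega pb = pc.
Proof. by rewrite (romega_word [:: true]) /= mulr1 star_pc. Qed.

Lemma pa_word (w : seq bool) : pa * word (rev w) = word (rev (rcons w false)).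
Proof. by rewrite rev_rcons; exact: wordM. Qed.

Lemma pb_word (w : seq bool) : pb * word (rev w) = word (rev (rcons w true)).
Proof. by rewrite rev_rcons; exact: wordM. Qed.

Lemma romega_aM (p : abpoly) : romega (pa * p) = pc * romega p.
Proof.
apply: (@additive_ext (fun p => romega (pa * p)) (fun p => pc * romega p))
  => {p} [p q|p q|w].
- by rewrite mulrBr raddfB.
- by rewrite raddfB mulrBr.
rewrite -[w]revK pa_word !romega_word.
have [-> _ _] := replace_word_recr pc (pd *+ 2) (rev w).
by rewrite starM; congr (_ * _); exact: star_pc.
Qed.

Lemma romega_baM (p : abpoly) :
  romega (pb * (pa * p)) = (pd *+ 2) * romega p.
Proof.
apply: (@additive_ext (fun p => romega (pb * (pa * p)))
  (fun p => (pd *+ 2) * romega p)) => {p} [p q|p q|w].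
- by rewrite [pa * _]mulrBr [pb * _]mulrBr raddfB.
- by rewrite raddfB mulrBr.
rewrite -[w]revK pa_word pb_word.
rewrite !romega_word.
have [_ -> _] := replace_word_recr pc (pd *+ 2) (rev w).
rewrite starM; congr (_ * _); apply: etrans (starMn _ _) _; congr (_ *+ _).
exact: star_pd.
Qed.

Lemma romega_bbM (p : abpoly) :
  romega (pb * (pb * p)) = pc * romega (pb * p).
Proof.
apply: (@additive_ext (fun p => romega (pb * (pb * p)))
  (fun p => pc * romega (pb * p))) => {p} [p q|p q|w].
- by rewrite ![pb * (_ - _)]mulrBr raddfB.
- by rewrite ![pb * (_ - _)]mulrBr raddfB mulrBr.
rewrite -[w]revK !pb_word.
rewrite !romega_word.
have [_ _ ->] := replace_word_recr pc (pd *+ 2) (rev w).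
by rewrite starM; congr (_ * _); exact: star_pc.
Qed.

(** The integer coefficients have no torsion; this removes the factor 2 brought in by 2b = c - e. *)
Lemma abpoly_double_inj (p q : abpoly) : p *+ 2 = q *+ 2 -> p = q.
Proof.
move=> pq; apply/malgP => w.
have /(congr1 (mcoeff w)) := pq; rewrite !mcoeffMn => /eqP.
by rewrite eqr_pMn2r // => /eqP.
Qed.

(** * Sums over chains *)

Section RankedPoset.
Variables (S : nzRingType) (eb ee : S).
Variables (T : finType) (le : rel T) (d : T -> nat).
Hypothesis le_refl : reflexive le.
Hypothesis le_trans : transitive le.
Hypothesis d_lt : forall x y, le x y -> x != y -> (d x < d y)%N.

(** Index i stands for rank i + 1, so the word covers the ranks k + 1, ..., r, where k is the rank
    of the element below the chain. *)
Definition chain_weight (k r : nat) (C : {set T}) : S :=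
  \prod_(k <= i < r) (if [exists x in C, d x == i.+1] then eb else ee).

Definition above (r : nat) (x : T) : {set T} :=
  [set y | [&& le x y, y != x & (d y <= r)%N]].

Definition chain_sum (r : nat) (x : T) : S :=
  \sum_(C : {set T} | chain le C && (C \subset above r x))
     chain_weight (d x) r C.

Let is_min (C : {set T}) (y : T) := (y \in C) && [forall z in C, le y z].

(** Stated as an equality with [pred1] so that a sum over chains can be split according to the
    smallest element, each chain being counted once. *)
Lemma chain_has_min (C : {set T}) : chain le C -> C != set0 ->
  exists y, is_min C =1 pred1 y.
Proof.
move=> /forall_inP chC /set0Pn[c cC].
case: (arg_minnP d cC) => y yC miny.
have leyz z : z \in C -> le y z.
  move=> zC; have /forall_inP/(_ z zC)/orP[//|lezy] := chC y yC.
  have [->//|zy] := eqVneq z y.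
  by have := d_lt lezy zy; rewrite ltnNge miny.
exists y => z; apply/andP/eqP => [[zC /forall_inP/(_ y yC) lezy]|->].
  apply/eqP; apply/negPn/negP => zy.
  by have := d_lt lezy zy; rewrite ltnNge miny.
by split=> //; apply/forall_inP.
Qed.

Lemma chain_weight0 (k r : nat) : chain_weight k r set0 = ee ^+ (r - k).
Proof.
rewrite /chain_weight (eq_bigr (fun=> ee)) ?prodr_const_nat // => i _.
by case: existsP => // -[x]; rewrite inE.
Qed.

Lemma chain_weight_cons (r : nat) (x y : T) (C : {set T}) :
  y \in above r x -> C \subset above r y ->
  chain_weight (d x) r (y |: C) =
    ee ^+ (d y - d x - 1) * (eb * chain_weight (d y) r C).
Proof.
rewrite inE => /and3P[lexy yx dyr] /subsetP sC.
have dxy : (d x < d y)%N by apply: d_lt => //; rewrite eq_sym.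
have dC z : z \in C -> (d y < d z)%N.
  by move=> /sC; rewrite inE => /and3P[? ? _]; apply: d_lt => //; rewrite eq_sym.
have dy1 : (d x <= (d y).-1)%N by rewrite -ltnS prednK // (leq_trans _ dxy).
(* The letter of rank d y has index (d y).-1; the product is split just before it. *)
rewrite /chain_weight (@big_cat_nat _ _ _ (d y).-1) //=; last first.
  by rewrite (leq_trans (leq_pred _)).
congr (_ * _).
  rewrite (eq_big_nat _ _ (F2 := fun=> ee)) ?prodr_const_nat.
    by rewrite -subnAC subn1.
  move=> i /andP[_ ilt]; case: existsP => // -[z /andP[+ /eqP dz]].
  have iy : (i.+1 < d y)%N by rewrite -ltn_predRL.
  rewrite !inE => /orP[/eqP zy|/dC]; first by rewrite -dz zy ltnn in iy.
  by rewrite dz ltnNge ltnW.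
have y0 : (0 < d y)%N by exact: leq_trans dxy.
rewrite big_ltn ?prednK //; congr (_ * _).
  by case: existsP => // -[]; exists y; rewrite !inE eqxx /= eqxx.
apply: eq_big_nat => i /andP[ylt _].
congr (if _ then _ else _); apply/existsP/existsP => -[z /andP[]].
  rewrite !inE => /orP[/eqP ->|zC] dz; last by exists z; rewrite zC.
  by move: ylt; rewrite (eqP dz) ltnn.
by move=> zC dz; exists z; rewrite !inE zC orbT.
Qed.

Lemma chain_sumE (r : nat) (x : T) :
  chain_sum r x = ee ^+ (r - d x) +
    \sum_(y in above r x) ee ^+ (d y - d x - 1) * (eb * chain_sum r y).
Proof.
rewrite /chain_sum (bigD1 set0) /=; last first.
  by rewrite sub0set andbT; apply/forall_inP => z; rewrite inE.
rewrite chain_weight0; congr (_ + _).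
rewrite (eq_bigr (fun C => \sum_(y | is_min C y) chain_weight (d x) r C)); last first.
  move=> C /andP[/andP[chC _] C0].
  by have [y hy] := chain_has_min chC C0; rewrite (eq_bigl _ _ hy) big_pred1_eq.
rewrite (exchange_big_dep (mem (above r x))) /=; last first.
  by move=> C y /andP[/andP[_ /subsetP sC] _] /andP[yC _]; exact: sC.
apply: eq_bigr => y yx.
(* Nonempty chains with smallest element y correspond to chains strictly above y by adding or
   removing y. *)
rewrite (reindex_onto (setU [set y]) (fun C => C :\ y)) /=; last first.
  by move=> C /andP[_ /andP[yC _]]; rewrite setD1K.
rewrite !mulr_sumr; apply: eq_big => [C|C /andP[h /eqP yC]].
  apply/idP/idP.
    move=> /andP[/andP[/andP[/andP[chC sC] _] /andP[_ miny]] /eqP yC].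
    have CyC z : z \in C -> z \in y |: C by move=> zC; rewrite !inE zC orbT.
    apply/andP; split.
      apply/forall_inP => z zC; apply/forall_inP => t tC.
      by have /forall_inP/(_ z (CyC z zC))/forall_inP/(_ t (CyC t tC)) := chC.
    apply/subsetP => z zC.
    have /subsetP/(_ z (CyC z zC)) := sC; rewrite !inE => /and3P[_ _ ->].
    have /forall_inP/(_ z (CyC z zC)) -> := miny; rewrite andbT /=.
    by move: zC; rewrite -yC !inE => /andP[].
  move=> /andP[chC /subsetP sC].
  have leyC z : z \in y |: C -> le y z.
    rewrite !inE => /orP[/eqP->|/sC]; first exact: le_refl.
    by rewrite inE => /andP[].
  have yC : y \notin C by apply/negP => /sC; rewrite inE eqxx andbF.
  rewrite setU1K // eqxx andbT; apply/andP; split.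
    apply/andP; split; last by apply/set0Pn; exists y; rewrite !inE eqxx.
    apply/andP; split.
      apply/forall_inP => z zC; apply/forall_inP => t tC.
      have := leyC z zC; have := leyC t tC; move: zC tC; rewrite !inE.
      case/orP=> [/eqP->|zC] /orP[/eqP->|tC] => [->|->|_ ->|_ _] //.
        by rewrite orbT.
      by have /forall_inP/(_ z zC)/forall_inP/(_ t tC) := chC.
    apply/subsetP => z; rewrite inE => /orP[|/sC]; first by rewrite inE => /eqP->.
    move: yx; rewrite !inE => /and3P[lexy yx dyr] /and3P[leyz zy ->].
    rewrite (le_trans lexy leyz) andbT /=; apply/eqP => zx.
    have := d_lt lexy; rewrite eq_sym yx => /(_ isT); rewrite -zx => h1.
    by have := d_lt leyz; rewrite eq_sym zy => /(_ isT); rewrite ltnNge ltnW.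
  by rewrite /is_min !inE eqxx /=; apply/forall_inP.
apply: chain_weight_cons => //.
move: h => /andP[/andP[/andP[_ /subsetP sC] _] /andP[_ /forall_inP miny]].
have CyC z : z \in C -> z \in y |: C by move=> zC; rewrite !inE zC orbT.
apply/subsetP => z zC; have := sC z (CyC z zC); rewrite !inE => /and3P[_ _ ->].
rewrite miny ?CyC // andbT /=.
by move: zC; rewrite -yC !inE => /andP[].
Qed.

(** Allowing chains to contain the maximum, of rank r + 1, adds one letter, b or e according to its
    presence; hence the factor e + b. At the maximum itself no letter remains, and the value is
    1. *)
Lemma chain_sum_top (r : nat) (top : T) (x : T) :
  (forall y, le y top) -> d top = r.+1 ->
  let Xi y := if y == top then 1 else chain_sum r y * (ee + eb) in
  Xi x = ee ^+ (r.+1 - d x) +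
    \sum_(y | le x y && (y != x)) ee ^+ (d y - d x - 1) * (eb * Xi y).
Proof.
move=> top_max dtop Xi.
have dr y : y != top -> (d y <= r)%N.
  by move=> ytop; rewrite -ltnS -dtop; exact: d_lt.
have [->|xtop] := eqVneq x top.
  rewrite /Xi eqxx dtop subnn expr0 big1 ?addr0 // => y /andP[ley yt].
  have := d_lt (top_max y) yt; have := d_lt ley; rewrite eq_sym yt => /(_ isT).
  by move=> h1 h2; move: (ltn_trans h1 h2); rewrite ltnn.
rewrite (bigD1 top) /=; last by rewrite top_max eq_sym.
have -> : Xi x = chain_sum r x * (ee + eb) by rewrite /Xi (negPf xtop).
have -> : Xi top = 1 by rewrite /Xi eqxx.
rewrite mulr1 dtop chain_sumE mulrDl mulrDr addrA.
have -> : (r.+1 - d x - 1 = r - d x)%N by rewrite subn1 subSn ?dr.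
rewrite subSn ?dr // exprSr; congr (_ + _); rewrite mulr_suml.
apply: eq_big => [y|y].
  rewrite inE; apply/and3P/andP => [[-> -> dy]|[/andP[-> ->] /dr]] //.
  by split=> //; apply: contraTneq dy => ->; rewrite dtop ltnn.
rewrite inE => /and3P[_ _ dy]; rewrite /Xi ifN ?mulrA //.
by apply: contraTneq dy => ->; rewrite dtop ltnn.
Qed.

End RankedPoset.

(** * The ab-index as a sum over chains *)

Definition pe : abpoly := pa - pb.

Lemma star_pe : star pe = pe.
Proof.
have starB : {morph star : p q / p - q} by exact: raddfB.
by rewrite /pe starB star_pa star_pb.
Qed.

Section NoncommutativeProducts.
Variables (S : nzRingType) (I : eqType).
Implicit Types (s : seq I) (g : I -> S).

Lemma prodr_seq_eq0 s g i : i \in s -> g i = 0 -> \prod_(j <- s) g j = 0.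
Proof.
move=> + gi; elim: s => // j s IHs; rewrite inE big_cons.
by case/orP=> [/eqP<-|/IHs ->]; rewrite ?gi ?mul0r ?mulr0.
Qed.

Lemma prodr_sign_mul s (k : I -> nat) g :
  \prod_(j <- s) ((-1) ^+ k j * g j) =
  (-1) ^+ (\sum_(j <- s) k j) * \prod_(j <- s) g j.
Proof.
elim: s => [|j s IHs]; first by rewrite !big_nil mul1r.
rewrite !big_cons IHs exprD -!mulrA; congr (_ * _); rewrite !mulrA.
by congr (_ * _); rewrite -signr_odd commr_sign.
Qed.

End NoncommutativeProducts.

(** Expand the factors a - b outside U; V collects the positions of U and those where -b is chosen.
    This is the inversion between the f and h numbers, transposed to words. *)
Lemma inclusion_exclusion_prod (S : nzRingType) (a b : S) (r : nat)
    (U : {set 'I_r}) :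
  \prod_(i < r) (if i \in U then b else a - b) =
  \sum_(V : {set 'I_r} | U \subset V)
     (-1) ^+ #|V :\: U| * \prod_(i < r) (if i \in V then b else a).
Proof.
(* The choice [t] takes b when true. On U the other choice has value 0, which removes every V that
   does not contain U. *)
pose F (i : 'I_r) (t : bool) :=
  if i \in U then if t then b else 0 else if t then - b else a.
rewrite (eq_bigr (fun i => \sum_(t : bool) F i t)); last first.
  by move=> i _; rewrite big_bool /F; case: (i \in U) => /=; [rewrite addr0|exact: addrC].
rewrite bigA_distr_bigA.
rewrite (reindex (fun V : {set 'I_r} => [ffun i => i \in V])) /=; last first.
  exists (fun f => [set i | f i]) => [V _|f _].
    by apply/setP=> i; rewrite inE ffunE.
  by apply/ffunP=> i; rewrite ffunE inE.
rewrite [LHS](bigID (fun V : {set 'I_r} => U \subset V)) /=.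
rewrite [X in _ + X]big1 ?addr0; last first.
  move=> V /subsetPn[i iU iV]; apply: (prodr_seq_eq0 (mem_index_enum i)).
  by rewrite ffunE /F iU (negPf iV).
apply: eq_bigr => V /subsetP UV.
rewrite (eq_bigr (fun i => (-1) ^+ (i \in V :\: U) * (if i \in V then b else a))).
  rewrite prodr_sign_mul; congr ((-1) ^+ _ * _).
  by rewrite -sum1_card [RHS]big_mkcond; apply: eq_bigr => i _; case: (_ \in _).
move=> i _; rewrite ffunE /F inE.
have [iU|iU] /= := boolP (i \in U); first by rewrite UV // mul1r.
by case: (i \in V); rewrite ?mul1r // mulN1r.
Qed.

Lemma word_map (I : Type) (s : seq I) (f : I -> bool) :
  word (map f s) = \prod_(i <- s) word [:: f i].
Proof.
elim: s => [|i s IHs]; first by rewrite big_nil; exact: word0.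
by rewrite big_cons -IHs; apply: esym; exact: wordM.
Qed.

Section ABIndexAsChainSum.
Variables (T : finType) (le : rel T).
Let r := nranks le.

(** A chain has a single rank set, so the chains counted by the various [flag_f] partition those
    avoiding the ranks 0 and r + 1. *)
Lemma flag_f_sum (W : nmodType) (X : {set 'I_r} -> W) :
  \sum_(U : {set 'I_r}) X U *+ flag_f (le := le) U =
  \sum_(C : {set T} | chain le C && [forall x in C, 0 < rank le x <= r]%N)
     X [set i : 'I_r | [exists x in C, rank le x == i.+1]].
Proof.
pose P (C : {set T}) (U : {set 'I_r}) := chain le C && has_rank_set C U.
transitivity (\sum_(U : {set 'I_r}) \sum_(C : {set T} | P C U) X U).
  apply: eq_bigr => U _; rewrite sumr_const /flag_f; congr (_ *+ _).
  by apply: eq_card => C; exact: asboolb.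
rewrite (exchange_big_dep
  (fun C => chain le C && [forall x in C, 0 < rank le x <= r]%N)) /=.
  apply: eq_bigr => C /andP[chC /forall_inP rC].
  set U0 := [set _ | _].
  have inU0 i : (i \in U0) = [exists x in C, rank le x == i.+1] by rewrite inE.
  rewrite (big_pred1 U0) // => U /=.
  rewrite /P chC /= /has_rank_set; apply/andP/eqP => [[/forall_inP h1 /forall_inP h2]|->].
    apply/setP => i; rewrite inU0; apply/idP/idP; first exact: h2.
    case/exists_inP=> x xC /eqP rx; have /exists_inP[j jU] := h1 x xC.
    by rewrite rx eqSS => /eqP/val_inj ->.
  split; last by apply/forall_inP => i; rewrite inU0.
  apply/forall_inP => x xC.
  have /andP[x0 xr] := rC x xC.
  have ltr : ((rank le x).-1 < r)%N by rewrite prednK.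
  apply/exists_inP; exists (Ordinal ltr); rewrite ?inU0 /= prednK //.
  by apply/exists_inP; exists x.
move=> U C _ /andP[-> /andP[/forall_inP h1 _]] /=.
apply/forall_inP => x /h1/exists_inP[i _ /eqP ->].
by rewrite ltnS leq0n ltn_ord.
Qed.

(** Exchanging the sums moves the alternating signs from the flag numbers to the words. *)
Lemma flag_h_sum (A : lalgType int) (X : {set 'I_r} -> A) :
  \sum_(V : {set 'I_r}) flag_h (le := le) V *: X V =
  \sum_(U : {set 'I_r})
    (\sum_(V : {set 'I_r} | U \subset V) (-1) ^+ #|V :\: U| * X V)
      *+ flag_f (le := le) U.
Proof.
under [RHS]eq_bigr do rewrite -sumrMnl.
rewrite (exchange_big_dep xpredT) //=; apply: eq_bigr => V _.
rewrite /flag_h scaler_suml; apply: eq_bigr => U _.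
by rewrite mulrC -scalerA -signr_odd scaler_sign -(signr_odd A) mulr_sign
  -[in RHS]scaler_nat natz.
Qed.

Lemma Psi_chain_sum :
  Psi le =
  \sum_(C : {set T} | chain le C && [forall x in C, 0 < rank le x <= r]%N)
     chain_weight pb pe (rank le) 0 r C.
Proof.
have wE (V : {set 'I_r}) : word [seq i \in V | i <- enum 'I_r] =
    \prod_(i < r) (if i \in V then pb else pa).
  by rewrite word_map enumT [index_enum _]unlock; apply: eq_bigr => i _; case: ifP.
have chE (C : {set T}) : chain_weight pb pe (rank le) 0 r C =
    \prod_(i < r) (if i \in [set i : 'I_r | [exists x in C, rank le x == i.+1]]
                   then pb else pa - pb).
  by rewrite /chain_weight big_mkord; apply: eq_bigr => i _; rewrite inE.
under [RHS]eq_bigr do rewrite chE.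
rewrite -(flag_f_sum (fun U => \prod_(i < r) (if i \in U then pb else pa - pb))).
rewrite /Psi; under eq_bigr do rewrite wE.
apply: etrans (flag_h_sum (fun V => \prod_(i < r) (if i \in V then pb else pa))) _.
by apply: eq_bigr => U _; congr (_ *+ _); rewrite inclusion_exclusion_prod.
Qed.

End ABIndexAsChainSum.

(** * The reversed omega and the comparison of the two recursions, over an abstract ring *)

Lemma sqr_sub_noncomm (S : nzRingType) (x y : S) :
  (x - y) * (x - y) = (x + y) * (x + y) - (x * y + y * x) *+ 2.
Proof.
rewrite !mulrDr !mulrDl !mulrN !mulNr opprK mulr2n.
set xx := x * x; set xy := x * y; set yx := y * x; set yy := y * y.
have -> : xx + yx + (xy + yy) = xx + yy + (xy + yx).
  by rewrite (addrC xy yy) addrACA (addrC yx).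
have -> : xx - yx + (- xy + yy) = xx + yy - (xy + yx).
  by rewrite [- xy + yy]addrC addrACA opprD [- yx - xy]addrC.
by set w := xy + yx; rewrite [- (w + w)]opprD addrA addrK.
Qed.

Section ReversedOmega.
Variables (S : nzRingType) (a b dd : S) (Om : {additive S -> S}).
Let c := a + b.
Let e := a - b.
Hypothesis eeE : e * e = c * c - dd.
Hypothesis Om1 : Om 1 = 1.
Hypothesis Omb : Om b = c.
Hypothesis OmaM : forall p, Om (a * p) = c * Om p.
Hypothesis OmbaM : forall p, Om (b * (a * p)) = dd * Om p.
Hypothesis OmbbM : forall p, Om (b * (b * p)) = c * Om (b * p).

Lemma Om_eM (p : S) : Om (e * p) = c * Om p - Om (b * p).
Proof. by rewrite mulrBl raddfB /= OmaM. Qed.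

(** The two terms c Om(b p) cancel, and what remains is c c - dd = e e, where [dd] stands for 2d. *)
Lemma Om_eeM (p : S) : Om (e * (e * p)) = e * e * Om p.
Proof.
have OmbeM : Om (b * (e * p)) = dd * Om p - c * Om (b * p).
  by rewrite mulrBl mulrBr raddfB /= OmbaM OmbbM.
rewrite !Om_eM OmbeM eeE mulrBr mulrBl !mulrA opprB.
by rewrite addrA subrK.
Qed.

Lemma Om_e_even (k : nat) (p : S) : ~~ odd k ->
  Om (e ^+ k * p) = e ^+ k * Om p.
Proof.
move=> /even_halfK <-; elim: k./2 => [|j IHj]; first by rewrite !expr0 !mul1r.
by rewrite doubleS !exprS -!mulrA Om_eeM IHj !mulrA.
Qed.

Lemma Om_e_odd (k : nat) (p : S) : odd k ->
  Om (e ^+ k * p) = e ^+ k.-1 * (c * Om p - Om (b * p)).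
Proof.
case: k => // k /= ok.
by rewrite exprSr -mulrA Om_e_even // Om_eM.
Qed.

(** The words a b p and b b p have the same image, so e b p is killed; an odd power leaves one such
    e in front of b after the pairs have been taken out. *)
Lemma Om_eb (k : nat) (p : S) :
  Om (e ^+ k * (b * p)) = if odd k then 0 else e ^+ k * Om (b * p).
Proof.
case: ifPn => ok; last exact: Om_e_even.
by rewrite Om_e_odd // OmbbM subrr mulr0.
Qed.

Lemma Om_e (k : nat) : Om (e ^+ k) = if odd k then 0 else e ^+ k.
Proof.
rewrite -[X in Om X]mulr1; case: ifPn => ok.
  by rewrite Om_e_odd // Om1 !mulr1 Omb subrr mulr0.
by rewrite Om_e_even // Om1 mulr1.
Qed.

Variables (n : nat) (Q : finType) (leQ : rel Q) (dQ : Q -> nat) (Xi : Q -> S).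
Hypothesis leQ_refl : reflexive leQ.
Hypothesis leQ_trans : transitive leQ.
Hypothesis dQ_lt : forall x y, leQ x y -> x != y -> (dQ x < dQ y)%N.
Hypothesis XiE : forall x, Xi x = e ^+ (n - dQ x) +
  \sum_(y | leQ x y && (y != x)) e ^+ (dQ y - dQ x - 1) * (b * Xi y).

(** Signs are integers acting by [*~], so they pass freely through the noncommutative products. *)
Let sg (k : nat) : int := (-1) ^+ k.
Let Th x := Om (Xi x).
Let B x := Om (b * Xi x).

Lemma Om_Xi x : Th x = Om (e ^+ (n - dQ x)) +
  \sum_(y | leQ x y && (y != x)) Om (e ^+ (dQ y - dQ x - 1) * (b * Xi y)).
Proof. by rewrite /Th XiE raddfD raddf_sum. Qed.

Lemma sgE k (z : S) : z *~ sg k = if odd k then - z else z.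
Proof. by rewrite /sg -signr_odd; case: (odd k) => //; rewrite mulrNz. Qed.

(** Since 2b = c - e, the left side is Om(e Xi) + Om(b Xi) - e Om(Xi). A flat at distance k enters
    Om(e Xi) through e^k b and Om(Xi) through e^(k-1) b; exactly one of these survives Om, with sign
    (-1)^k. The remaining term Om(b Xi) is the summand y = x. *)
Lemma two_b_Om_Xi x : (b * Th x) *+ 2 =
  - (e ^+ (n - dQ x).+1 *~ sg (n - dQ x)) +
  \sum_(y | leQ x y) e ^+ (dQ y - dQ x) * B y *~ sg (dQ y - dQ x).
Proof.
have cE : b *+ 2 = c - e by rewrite /c /e opprB [b - a]addrC addrACA subrr add0r mulr2n.
rewrite -mulrnAl cE mulrBl.
have -> : c * Th x = Om (e * Xi x) + B x by rewrite Om_eM subrK.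
rewrite XiE mulrDr raddfD mulr_sumr raddf_sum /= Om_Xi mulrDr mulr_sumr.
rewrite [in RHS](bigD1 x (leQ_refl x)) /= !subnn expr0 mul1r mulr1z -exprS.
rewrite -[X in X - _]addrA [_ + B x]addrC opprD addrACA; congr (_ + _).
  by rewrite !Om_e sgE /=; case: odd; rewrite ?mulr0 ?subr0 ?opprK // -exprS sub0r.
rewrite -addrA; congr (_ + _).
rewrite -sumrB; apply: eq_bigr => y /andP[xy yx].
have dxy : (dQ x < dQ y)%N by apply: dQ_lt => //; rewrite eq_sym.
have [k kE] : exists k, (dQ y - dQ x = k.+1)%N.
  by exists (dQ y - dQ x).-1; rewrite prednK // subn_gt0.
rewrite kE subn1 /= mulrA -exprS !Om_eb sgE /=.
case: (odd k) => /=; first by rewrite mulr0 subr0.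
by rewrite sub0r mulrA -exprS.
Qed.

Variables (T : finType) (leT : rel T) (dT : T -> nat) (sp : T -> Q).
Variable (top : Q).
Hypothesis leT_refl : reflexive leT.
Hypothesis leT_trans : transitive leT.
Hypothesis dT_lt : forall x y, leT x y -> x != y -> (dT x < dT y)%N.
Hypothesis dQ_sp : forall x, (dT x <= n)%N -> dQ (sp x) = dT x.
Hypothesis sp_le : forall x y, (dT y <= n)%N -> leT x y -> leQ (sp x) (sp y).
Hypothesis top_max : forall x, leQ x top.
Hypothesis dQ_top : dQ top = n.
Hypothesis euler : forall x y, (dT x <= n)%N -> leQ (sp x) y ->
  \sum_(z in above leT dT n x | leQ (sp z) y) sg (dT z) = sg (dQ y) - sg (dT x).
Hypothesis double_inj : forall p q : S, p *+ 2 = q *+ 2 -> p = q.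

Lemma sgM j k : sg j * sg k = sg (j + k).
Proof. by rewrite /sg exprD. Qed.

Lemma sgB j k : (k <= j)%N -> sg (j - k) = sg j * sg k.
Proof.
by move=> kj; rewrite sgM /sg -signr_odd -[RHS]signr_odd oddB // oddD.
Qed.

Lemma sg_mulB j k : (k <= j)%N ->
  sg j * (sg j - sg k) = if odd (j - k) then 2 else 0.
Proof.
move=> kj; rewrite oddB // /sg -(signr_odd _ j) -(signr_odd _ k).
by case: (odd j); case: (odd k).
Qed.

(** Induction on the codimension. After doubling, [two_b_Om_Xi] is substituted for every face y
    above x, and the sums over faces and flats are exchanged. *)
Theorem chain_sum_Om x : (dT x <= n)%N -> chain_sum b e leT dT n x = Th (sp x).
Proof.
have [k] := ubnP (n - dT x); elim: k x => // k IH x kx xn.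
apply: double_inj; rewrite chain_sumE // mulrnDl -sumrMnl.
pose N := (n - dT x)%N.
(* The powers of e before and after y combine into exponents free of y, so only a sign depends on
   y. *)
have step y : y \in above leT dT n x ->
  e ^+ (dT y - dT x - 1) * (b * chain_sum b e leT dT n y) *+ 2 =
  - (e ^+ N *~ (sg n * sg (dT y))) +
  \sum_(z | leQ (sp y) z)
     e ^+ (dQ z - dT x - 1) * B z *~ (sg (dQ z) * sg (dT y)).
  rewrite inE => /and3P[xy yx yn].
  have dxy : (dT x < dT y)%N by apply: dT_lt => //; rewrite eq_sym.
  rewrite IH // ?(leq_trans _ kx) //; last first.
    by rewrite ltnS in kx *; rewrite (leq_trans _ kx) // ltn_sub2l // (leq_trans dxy).
  rewrite -mulrnAr two_b_Om_Xi dQ_sp // mulrDr mulrN mulrzAr mulr_sumr.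
  rewrite -exprD sgB //; congr (- (e ^+ _ *~ _) + _).
    by rewrite /N; lia.
  apply: eq_bigr => z yz; have := dQ_lt yz; rewrite dQ_sp // => dyz.
  have {}dyz : (dT y <= dQ z)%N.
    by have [<-|/dyz/ltnW//] := eqVneq (sp y) z; rewrite dQ_sp.
  rewrite mulrzAr mulrA -exprD sgB //; congr (e ^+ _ * _ *~ _).
  by lia.
rewrite (eq_bigr _ step) big_split /= sumrN -mulrz_sumr -mulr_sumr.
(* The Euler relation for the whole space accounts for the term without flats. *)
have -> : \sum_(z in above leT dT n x) sg (dT z) = sg n - sg (dT x).
  rewrite -[in RHS]dQ_top -(euler xn (top_max _)).
  by apply: eq_bigl => z; rewrite top_max andbT.
(* The span of x itself does not occur, since every face y above x has larger dimension. *)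
rewrite (exchange_big_dep (fun z => leQ (sp x) z && (z != sp x))) /=; last first.
  move=> y z; rewrite inE => /and3P[xy yx yn] yz.
  rewrite (leQ_trans (sp_le yn xy) yz); apply/eqP => zE.
  have dxy : (dT x < dT y)%N by apply: dT_lt => //; rewrite eq_sym.
  have := dQ_lt yz; rewrite zE !dQ_sp //.
  have [spE|_ /(_ isT)] := eqVneq (sp y) (sp x); last by rewrite ltnNge ltnW.
  by move: dxy; rewrite -(dQ_sp yn) spE dQ_sp // ltnn.
rewrite Om_Xi dQ_sp // mulrnDl -sumrMnl addrA; congr (_ + _).
  by rewrite sg_mulB // -/N Om_e; case: odd; rewrite /= ?subrr ?mul0rn ?subr0.
apply: eq_bigr => z /andP[xz zx].
rewrite -mulrz_sumr -mulr_sumr euler //.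
have dxz : (dT x < dQ z)%N.
  by rewrite -(dQ_sp xn); apply: dQ_lt => //; rewrite eq_sym.
rewrite sg_mulB; last exact: ltnW.
have [k' kE] : exists k', (dQ z - dT x = k'.+1)%N.
  by exists (dQ z - dT x).-1; rewrite prednK // subn_gt0.
rewrite kE subn1 /= Om_eb; case: (odd k') => /=; last by [].
by rewrite mul0rn.
Qed.

End ReversedOmega.

(** * Signs of affine forms *)

Section Sign.
Variable R : realType.
Implicit Types (x y t : R).

(** [None] is the sign 0. *)
Definition rsg x : option bool := if x == 0 then None else Some (0 < x).

Lemma rsg_none x : (rsg x = None) <-> (x = 0).
Proof. by rewrite /rsg; case: eqVneq => // /eqP. Qed.

Lemma rsg_pos x : (rsg x = Some true) <-> (0 < x).
Proof.
rewrite /rsg; case: eqVneq => [->|_]; first by rewrite ltxx.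
by split=> [[->]|->].
Qed.

Lemma rsg_neg x : (rsg x = Some false) <-> (x < 0).
Proof.
by rewrite /rsg; case: (ltrgtP x 0).
Qed.

Lemma rsgP x y : (rsg x = rsg y) <-> (Num.sg x = Num.sg y).
Proof.
split=> [|h]; last by rewrite /rsg -(sgr_eq0 x) -(sgr_gt0 x) h sgr_eq0 sgr_gt0.
case: (ltrgtP x 0) => [x0|x0|->].
- by have /rsg_neg -> := x0; move/esym/rsg_neg => y0; rewrite !ltr0_sg.
- by have /rsg_pos -> := x0; move/esym/rsg_pos => y0; rewrite !gtr0_sg.
- by have /rsg_none -> := erefl (0 : R); move/esym/rsg_none => ->.
Qed.

(** Membership in the closure of the set of reals of sign s: a closed half-line, or the point 0. *)
Definition weak_sign (s : option bool) x := (x == 0) || (rsg x == s).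

Lemma weak_signM s x t : 0 <= t -> weak_sign s x -> weak_sign s (t * x).
Proof.
rewrite le_eqVlt => /orP[/eqP<-|t0]; first by rewrite mul0r /weak_sign eqxx.
by rewrite /weak_sign /rsg mulf_eq0 (gt_eqF t0) /= (pmulr_rgt0 _ t0).
Qed.

Lemma weak_sign_none x : weak_sign None x = (x == 0).
Proof. by rewrite /weak_sign /rsg; case: eqP. Qed.

Lemma weak_sign_true x : weak_sign (Some true) x = (0 <= x).
Proof.
by rewrite /weak_sign /rsg; case: (ltrgtP x 0).
Qed.

Lemma weak_sign_false x : weak_sign (Some false) x = (x <= 0).
Proof.
by rewrite /weak_sign /rsg; case: (ltrgtP x 0).
Qed.

Lemma rsgD s x y : rsg x = s -> weak_sign s y -> rsg (x + y) = s.
Proof.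
case: s => [[]|].
- rewrite weak_sign_true => /rsg_pos x0 y0; apply/rsg_pos; lra.
- rewrite weak_sign_false => /rsg_neg x0 y0; apply/rsg_neg; lra.
- by rewrite weak_sign_none => /rsg_none -> /eqP ->; apply/rsg_none; rewrite addr0.
Qed.

Lemma weak_signD s x y : weak_sign s x -> weak_sign s y -> weak_sign s (x + y).
Proof.
case: s => [[]|]; rewrite ?weak_sign_true ?weak_sign_false ?weak_sign_none; try lra.
by move=> /eqP -> /eqP ->; rewrite addr0.
Qed.

Lemma weak_signD_eq0 s x y :
  weak_sign s x -> weak_sign s y -> x + y = 0 -> x = 0 /\ y = 0.
Proof.
case: s => [[]|]; rewrite ?weak_sign_true ?weak_sign_false ?weak_sign_none; try lra.
Qed.

Lemma rsg_ray s x y : (forall t, 0 <= t -> rsg (x + t * y) = s) -> weak_sign s y.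
Proof.
move=> h; have h0 := h 0 (lexx _); rewrite mul0r addr0 in h0.
(* For y nonzero the displacement t0 y has absolute value |x| + |y|, enough to carry x past 0 if y
   points the wrong way. *)
pose t0 := `|x| / `|y| + 1.
have t00 : 0 <= t0 by rewrite addr_ge0 // divr_ge0.
have := h _ t00; have [->|y0] := eqVneq y 0; first by rewrite /weak_sign eqxx.
have ty : t0 * `|y| = `|x| + `|y| by rewrite mulrDl mul1r divfK // normr_eq0.
case: s h0 {h} => [[]|].
- rewrite weak_sign_true leNgt => /rsg_pos x0 /rsg_pos h; apply/negP => yn.
  by rewrite (ltr0_norm yn) (gtr0_norm x0) in ty; lra.
- rewrite weak_sign_false leNgt => /rsg_neg x0 /rsg_neg h; apply/negP => yn.
  by rewrite (gtr0_norm yn) (ltr0_norm x0) in ty; lra.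
- move=> /rsg_none -> /rsg_none; rewrite add0r weak_sign_none => /eqP.
  rewrite mulf_eq0 => /orP[/eqP t0e|//].
  by rewrite t0e mul0r in ty; have := normr_gt0 y; rewrite y0; have := normr_ge0 x; lra.
Qed.

Lemma rsg_line s x : (forall t, rsg (x + t) = s) -> False.
Proof.
move=> h; have h0 := h (- x); have h1 := h (1 - x).
rewrite subrr in h0; rewrite addrC subrK -h0 in h1.
by move: h1; rewrite /rsg eqxx oner_eq0.
Qed.

Lemma rsg_stable x y : (rsg x = None -> y = 0) ->
  exists2 e, 0 < e & forall t, `|t| <= e -> rsg (x + t * y) = rsg x.
Proof.
have [-> /(_ (proj2 (rsg_none _) erefl)) ->|x0 _] := eqVneq x 0.
  by exists 1 => // t _; rewrite mulr0 addr0.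
have X0 : 0 < `|x| by rewrite normr_gt0.
have Y0 : 0 < `|y| + 1 by rewrite ltr_wpDl.
(* Adding 1 keeps the denominator positive when y = 0; halving makes |t y| < |x| strict. *)
exists (`|x| / (`|y| + 1) / 2) => [|t ht]; first by rewrite !divr_gt0.
have h : `|t * y| < `|x|.
  rewrite normrM.
  have h1 : `|t| * `|y| <= `|x| / (`|y| + 1) / 2 * `|y| by rewrite ler_wpM2r.
  apply: le_lt_trans h1 _.
  have qD : `|x| / (`|y| + 1) * (`|y| + 1) = `|x| by rewrite divfK // gt_eqF.
  have q0 : 0 < `|x| / (`|y| + 1) by rewrite divr_gt0.
  by rewrite mulrDr mulr1 in qD; rewrite mulrAC; lra.
have [xp|xn|x00] := ltrgtP 0 x; last by rewrite -x00 eqxx in x0.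
  have -> : rsg x = Some true by apply/rsg_pos.
  by apply/rsg_pos; rewrite (gtr0_norm xp) in h;
    have := ler_norm (- (t * y)); rewrite normrN; lra.
have -> : rsg x = Some false by apply/rsg_neg.
by apply/rsg_neg; rewrite (ltr0_norm xn) in h; have := ler_norm (t * y); lra.
Qed.

Lemma common_radius (I : finType) (P : I -> R -> Prop) :
  (forall i, exists2 e, 0 < e & forall t, `|t| <= e -> P i t) ->
  exists2 e, 0 < e & forall i t, `|t| <= e -> P i t.
Proof.
move=> h.
have {}h i : exists e, 0 < e /\ forall t, `|t| <= e -> P i t.
  by have [e e0 eP] := h i; exists e.
have [e eP] := choice h.
exists (\big[Order.min/1]_i e i) => [|i t te].
  by apply: lt_bigmin => // i _; have [] := eP i.
by have [_] := eP i; apply; apply: le_trans te _; exact: bigmin_le_cond.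
Qed.

Lemma sum_signs (V : nmodType) (F : option bool -> V) :
  \sum_s F s = F None + (F (Some true) + F (Some false)).
Proof.
rewrite (bigD1 None) //= (bigD1 (Some true)) //= (big_pred1 (Some false)) //.
by case=> [[]|].
Qed.

End Sign.

(** * The dot product in matrix terms *)

Section Dot.
Variables (R : realType) (n : nat).
Implicit Types (u v x : 'rV[R]_n).

Lemma dotE u v : dot u v = (u *m v^T) 0 0.
Proof. by rewrite /dot mxE; apply: eq_bigr => j _; rewrite mxE. Qed.

Lemma dotDr u v x : dot u (v + x) = dot u v + dot u x.
Proof. by rewrite !dotE linearD mulmxDr mxE. Qed.

Lemma dotZr u t v : dot u (t *: v) = t * dot u v.
Proof. by rewrite !dotE linearZ -scalemxAr mxE. Qed.

Lemma dot0r u : dot u 0 = 0.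
Proof. by rewrite -(scale0r 0) dotZr mul0r. Qed.

Lemma dot_eq0 u v : (dot u v == 0) = (u <= kermx v^T)%MS.
Proof.
apply/eqP/sub_kermxP => [h|h]; last by rewrite dotE h mxE.
by apply/matrixP => i j; rewrite !ord1 -dotE h mxE.
Qed.

End Dot.

(** * Euler relations *)

Section Cells.
Variables (R : realType) (n : nat) (A : arrangement R n).
Let m := size_arr A.
Let u (i : 'I_m) : 'rV[R]_n := normal_vec i.
Local Notation V := 'rV[R]_n.
Implicit Types (J K : {set 'I_m}) (i j k : 'I_m) (x y v w : V).

Definition affine_form i x : R := dot (u i) x - offset i.

Lemma evD i x t v : affine_form i (x + t *: v) = affine_form i x + t * dot (u i) v.
Proof. by rewrite /affine_form dotDr dotZr addrAC. Qed.

Definition normals J : 'M[R]_n := (\sum_(i in J) <<u i>>)%MS.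
(** The codimension of the intersection of the hyperplanes in J whenever it is nonempty. *)
Definition normals_rank J : nat := \rank (normals J).

Lemma normals_sub J i : i \in J -> (u i <= normals J)%MS.
Proof. by move=> iJ; rewrite -(genmxE (u i)); exact: (sumsmx_sup i). Qed.

Lemma normals_subP J p (M : 'M[R]_(p, n)) :
  (forall i, i \in J -> (u i <= M)%MS) -> (normals J <= M)%MS.
Proof. by move=> h; apply/sumsmx_subP => i iJ; rewrite genmxE h. Qed.

Lemma normalsS J K : J \subset K -> (normals J <= normals K)%MS.
Proof. by move=> /subsetP JK; apply: normals_subP => i /JK; exact: normals_sub. Qed.

Lemma rkS J K : J \subset K -> (normals_rank J <= normals_rank K)%N.
Proof. by move=> JK; apply: mxrankS; exact: normalsS. Qed.

Lemma rk_le J : (normals_rank J <= n)%N. Proof. exact: rank_leq_row. Qed.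

Lemma normals_dot0 J v w : (w <= normals J)%MS ->
  (forall j, j \in J -> dot (u j) v = 0) -> dot w v = 0.
Proof.
move=> wJ h; apply/eqP; rewrite dot_eq0; apply: submx_trans wJ _.
by apply: normals_subP => j jJ; rewrite -dot_eq0 h.
Qed.

(** A vector outside a row space is detected by some column of its cokernel matrix, here rescaled to
    take the value 1. *)
Lemma normals_dual J w : ~~ (w <= normals J)%MS ->
  exists v, (forall j, j \in J -> dot (u j) v = 0) /\ dot w v = 1.
Proof.
rewrite submxE => /eqP wn0.
have [l wl] : exists l, (w *m cokermx (normals J)) 0 l != 0.
  apply: contrapT => h; apply: wn0; apply/matrixP => i l; rewrite ord1 [RHS]mxE.
  by apply/eqP; apply/negPn/negP => hl; apply: h; exists l.
pose c := (w *m cokermx (normals J)) 0 l.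
pose v0 := (col l (cokermx (normals J)))^T.
have dv z : dot z v0 = (z *m cokermx (normals J)) 0 l.
  by rewrite dotE trmxK !mxE; apply: eq_bigr => l' _; rewrite mxE.
exists (c^-1 *: v0); split=> [j jJ|]; last by rewrite dotZr dv mulVf.
have := normals_sub jJ; rewrite submxE => /eqP h.
by rewrite dotZr dv h mxE mulr0.
Qed.

Lemma rkU1_in J i : (u i <= normals J)%MS -> normals_rank (i |: J) = normals_rank J.
Proof.
move=> iJ; apply/eqP; rewrite eqn_leq andbC rkS ?subsetUr //=.
apply: mxrankS; apply: normals_subP => j; rewrite !inE => /orP[/eqP -> //|].
exact: normals_sub.
Qed.

Lemma rkU1_notin J i : ~~ (u i <= normals J)%MS ->
  normals_rank (i |: J) = (normals_rank J).+1.
Proof.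
move=> iJ; have iJ' : i \notin J by apply: contra iJ; exact: normals_sub.
have rk1 : \rank (u i) = 1%N by rewrite rank_rV normal_vec_neq0.
rewrite /normals_rank /normals big_setU1 //= -/(normals J).
have := mxrank_sum_cap <<u i>>%MS (normals J); rewrite !genmxE rk1.
have -> : \rank (<<u i>> :&: normals J)%MS = 0%N.
  have : (<<u i>> :&: normals J < <<u i>>)%MS.
    rewrite ltmxE capmxSl /=; apply: contra iJ => h.
    by rewrite -(genmxE (u i)); apply: submx_trans h (capmxSr _ _).
  by move/rank_ltmx; rewrite genmxE rk1 ltnS leqn0 => /eqP.
by rewrite addn0 add1n.
Qed.

Implicit Types (s : {ffun 'I_m -> option bool}) (a : option bool).

(** K holds the hyperplanes inserted so far; the entries of s outside K impose nothing. *)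
Definition sign_cell K s x : Prop := forall i, i \in K -> rsg (affine_form i x) = s i.

Definition zero_indices K s : {set 'I_m} := finset (fun i => (i \in K) && (s i == None)).

Definition upd s i a : {ffun 'I_m -> option bool} :=
  [ffun j => if j == i then a else s j].

Lemma zeros_upd K s i a : i \notin K ->
  zero_indices (i |: K) (upd s i a) =
    if a is None then i |: zero_indices K s else zero_indices K s.
Proof.
move=> iK; apply/setP => j; rewrite inE ffunE !inE.
by have [->|ji] := eqVneq j i; case: a => [a|];
  rewrite !inE ?eqxx ?(negPf iK) ?(negPf ji).
Qed.

Lemma cell_upd K s i a x : i \notin K ->
  sign_cell (i |: K) (upd s i a) x <-> sign_cell K s x /\ rsg (affine_form i x) = a.
Proof.
move=> iK; split=> [h|[h hi] j].
  split=> [j jK|]; last by have := h i; rewrite ffunE eqxx !inE eqxx; apply.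
  have := h j; rewrite ffunE !inE jK orbT; case: eqVneq => [ji|_]; last exact.
  by rewrite ji (negPf iK) in jK.
by rewrite ffunE !inE; case: eqVneq => [->|_] //= jK; exact: h.
Qed.

Lemma cell_zeros K s x i : sign_cell K s x ->
  i \in zero_indices K s -> affine_form i x = 0.
Proof. by move=> h; rewrite inE => /andP[/h hi /eqP si]; apply/rsg_none; rewrite hi. Qed.

Lemma cell_move K s x v : sign_cell K s x ->
  (forall j, j \in zero_indices K s -> dot (u j) v = 0) ->
  exists2 e, 0 < e & forall t, `|t| <= e -> sign_cell K s (x + t *: v).
Proof.
move=> xK hv.
have [|e e0 he] := @common_radius R 'I_m
    (fun i t => i \in K -> rsg (affine_form i (x + t *: v)) = s i).
  move=> i; have [iK|iK] := boolP (i \in K); last by exists 1.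
  have [h|e e0 he] := @rsg_stable R (affine_form i x) (dot (u i) v).
    by apply: hv; rewrite inE iK -(xK i iK) h.
  by exists e => // t te _; rewrite evD he // xK.
by exists e => // t te i iK; exact: he.
Qed.

Lemma cell_convex K s x y t : 0 <= t -> t <= 1 -> sign_cell K s x -> sign_cell K s y ->
  sign_cell K s (x + t *: (y - x)).
Proof.
move=> t0 t1 xK yK i iK; rewrite evD.
have -> : affine_form i x + t * dot (u i) (y - x) =
    (1 - t) * affine_form i x + t * affine_form i y.
  have -> : dot (u i) (y - x) = affine_form i y - affine_form i x.
    by rewrite /affine_form -(scaleN1r x) dotDr dotZr; ring.
  by ring.
have := xK i iK; have := yK i iK.
case: (s i) => [[]|].
- by move=> /rsg_pos hy /rsg_pos hx; apply/rsg_pos; nra.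
- by move=> /rsg_neg hy /rsg_neg hx; apply/rsg_neg; nra.
- by move=> /rsg_none -> /rsg_none ->; apply/rsg_none; rewrite !mulr0 addr0.
Qed.

(** If u_i is spanned by the normals vanishing on the cell, the form is constant there. Otherwise a
    zero inside the cell can be left in both directions by a small move, and without a zero
    convexity forces a single sign. The clause on [None] ensures that a form vanishing on the cell
    does not raise the rank. *)
Lemma cell_trichotomy K s i x0 : sign_cell K s x0 ->
  (exists a, (forall x, sign_cell K s x -> rsg (affine_form i x) = a) /\
     (a = None -> (u i <= normals (zero_indices K s))%MS)) \/
  (~~ (u i <= normals (zero_indices K s))%MS /\
   forall a, exists2 x, sign_cell K s x & rsg (affine_form i x) = a).
Proof.
move=> x0K; have [iN|iN] := boolP (u i <= normals (zero_indices K s))%MS.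
  left; exists (rsg (affine_form i x0)); split=> // x xK; congr rsg.
  suff : dot (u i) (x - x0) = 0.
    by rewrite /affine_form -(scaleN1r x0) dotDr dotZr; lra.
  apply: normals_dot0 iN _ => j jK.
  have := cell_zeros xK jK; have := cell_zeros x0K jK.
  by rewrite /affine_form -(scaleN1r x0) dotDr dotZr; lra.
have [v [hv iv]] := normals_dual iN.
have [[x xK xi]|nozero] := EM (exists2 x, sign_cell K s x & affine_form i x = 0).
  right; split=> // a.
  have [e e0 he] := cell_move xK hv.
  case: a => [[]|]; last by exists x => //; apply/rsg_none.
    exists (x + e *: v); first by apply: he; rewrite gtr0_norm.
    by apply/rsg_pos; rewrite evD xi iv add0r mulr1.
  exists (x + (- e) *: v); first by apply: he; rewrite normrN gtr0_norm.
  by apply/rsg_neg; rewrite evD xi iv add0r mulr1 oppr_lt0.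
left; exists (rsg (affine_form i x0)); split; last first.
  by move/rsg_none => h; case: nozero; exists x0.
move=> x xK; apply: contrapT => hne; have nz := nozero; apply: nozero.
have x0n : affine_form i x0 != 0 by apply/eqP => h; apply: nz; exists x0.
have xn : affine_form i x != 0 by apply/eqP => h; apply: nz; exists x.
have dxE : dot (u i) (x - x0) = affine_form i x - affine_form i x0.
  by rewrite /affine_form -(scaleN1r x0) dotDr dotZr; ring.
have opp : affine_form i x0 * affine_form i x < 0.
  rewrite ltNge; apply/negP => h; apply: hne.
  case: (ltrgtP (affine_form i x0) 0) x0n => // h0 _;
  case: (ltrgtP (affine_form i x) 0) xn => // h1 _.
  - by have /rsg_neg -> := h0; have /rsg_neg -> := h1.
  - by have := nmulr_rlt0 (affine_form i x) h0; rewrite h1 => h2; rewrite leNgt h2 in h.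
  - by have := pmulr_rlt0 (affine_form i x) h0; rewrite h1 => h2; rewrite leNgt h2 in h.
  - by have /rsg_pos -> := h0; have /rsg_pos -> := h1.
have d0 : affine_form i x0 - affine_form i x != 0 by apply/eqP => h; nra.
(* The parameter at which the segment from x0 to x meets the hyperplane. *)
pose t := affine_form i x0 / (affine_form i x0 - affine_form i x).
have tE : t * (affine_form i x0 - affine_form i x) = affine_form i x0 by rewrite divfK.
exists (x0 + t *: (x - x0)); last by rewrite evD dxE; lra.
by apply: cell_convex => //; [nra|nra].
Qed.

Lemma rk_zeros_upd K s i a : i \notin K ->
  normals_rank (zero_indices (i |: K) (upd s i a)) =
    (normals_rank (zero_indices K s) +
       ((a == None) && ~~ (u i <= normals (zero_indices K s))%MS))%N.
Proof.
move=> iK; rewrite zeros_upd //; case: a => [a|] /=; first by rewrite addn0.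
have [h|h] := boolP (u i <= normals (zero_indices K s))%MS; rewrite /= ?addn0 ?addn1.
  exact: rkU1_in.
exact: rkU1_notin.
Qed.

Definition nonempty_cell K s : Prop := exists x, sign_cell K s x.

(** The exponent is the codimension of the cell, so up to the global sign (-1)^n this is the
    compactly supported Euler characteristic of a relatively open cell. *)
Definition chi K s : int :=
  if `[< nonempty_cell K s >] then (-1) ^+ normals_rank (zero_indices K s) else 0.

Lemma nonempty_upd K s i a : i \notin K ->
  `[< nonempty_cell (i |: K) (upd s i a) >] =
  `[< exists2 x, sign_cell K s x & rsg (affine_form i x) = a >].
Proof.
move=> iK; apply: asbool_equiv_eq; split=> [[x /(cell_upd _ _ _ iK)[h1 h2]]|[x h1 h2]].
  by exists x.
by exists x; apply/cell_upd.
Qed.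

(** A cell that is really cut leaves two pieces of its own dimension and a wall of one dimension
    less, and z + z - z = z. Otherwise one piece survives, with the same rank. *)
Lemma chi_cut K s i : i \notin K ->
  chi K s = \sum_a chi (i |: K) (upd s i a).
Proof.
move=> iK; rewrite sum_signs /chi !nonempty_upd // !rk_zeros_upd //= !addn0.
case: asboolP => [[x0 x0K]|ne]; last first.
  have hE b : `[< exists2 x, sign_cell K s x & rsg (affine_form i x) = b >] = false.
    by apply/negbTE/asboolPn => -[x xK _]; apply: ne; exists x.
  by rewrite !hE !addr0.
have [[a [ha aN]]|[iN h]] := cell_trichotomy i x0K.
  have hE b : `[< exists2 x, sign_cell K s x & rsg (affine_form i x) = b >] = (b == a).
    by apply/asboolP/eqP => [[x /ha -> //]|->]; exists x0 => //; exact: ha.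
  rewrite !hE; case: a aN {ha hE} => [[]|] aN /=; rewrite ?add0r ?addr0 //.
  by rewrite aN // addn0.
have hE b : `[< exists2 x, sign_cell K s x & rsg (affine_form i x) = b >].
  by apply/asboolP/h.
by rewrite !hE iN addn1 exprS mulN1r addKr.
Qed.

Definition lineality K v : Prop := forall i, i \in K -> dot (u i) v = 0.

Definition recession K s v : Prop :=
  forall i, i \in K -> weak_sign (s i) (dot (u i) v).

Definition bounded_cell K s : Prop :=
  forall v, recession K s v -> lineality K v.

(** The sum of the ranks has the parity of their difference, which is the dimension of the cell
    modulo its lineality space. *)
Definition chib K s : int :=
  if `[< nonempty_cell K s /\ bounded_cell K s >]
  then (-1) ^+ (normals_rank K + normals_rank (zero_indices K s)) else 0.

Lemma recession_upd K s i a v : i \notin K ->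
  recession (i |: K) (upd s i a) v <->
  recession K s v /\ weak_sign a (dot (u i) v).
Proof.
move=> iK; split=> [h|[h hi] j].
  split=> [j jK|]; last by have := h i; rewrite ffunE eqxx !inE eqxx; apply.
  have := h j; rewrite ffunE !inE jK orbT; case: eqVneq => [ji|_]; last exact.
  by rewrite ji (negPf iK) in jK.
by rewrite ffunE !inE; case: eqVneq => [->|_] //= jK; exact: h.
Qed.

Lemma linealityU1 K i v :
  lineality (i |: K) v <-> dot (u i) v = 0 /\ lineality K v.
Proof.
split=> [h|[hi h] j]; last by rewrite !inE => /orP[/eqP->|/h].
by split=> [|j jK]; apply: h; rewrite !inE ?eqxx ?jK ?orbT.
Qed.

Lemma cell_ray K s x v t : 0 <= t -> sign_cell K s x -> recession K s v ->
  sign_cell K s (x + t *: v).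
Proof.
move=> t0 xK vK i iK; rewrite evD; apply: rsgD; first exact: xK.
by apply: weak_signM => //; exact: vK.
Qed.

Lemma lineality_recession K s v t : lineality K v -> recession K s (t *: v).
Proof. by move=> h i iK; rewrite dotZr h // mulr0 /weak_sign eqxx. Qed.

(** Suppose the cell is really cut. If u_i is independent of the normals of K, the lineality space
    shrinks: both sides become unbounded, and the wall inherits boundedness and weight, both ranks
    growing by 1. If u_i is dependent, a bounded cell has three bounded pieces, with z + z - z = z.
    An unbounded cell has a recession direction v outside the lineality space: the pieces on the
    side to which v points are unbounded, while the opposite side is bounded exactly when the wall
    is, and their weights cancel. *)
Lemma chib_cut K s i : i \notin K ->
  chib K s = \sum_a chib (i |: K) (upd s i a).
Proof.
move=> iK.
have emptyE b : ~ (exists2 x, sign_cell K s x & rsg (affine_form i x) = b) ->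
    chib (i |: K) (upd s i b) = 0.
  rewrite /chib => h; case: asboolP => // -[[x /(cell_upd _ _ _ iK)[h1 h2]] _].
  by case: h; exists x.
have [[x0 x0K]|ne] := EM (nonempty_cell K s); last first.
  rewrite sum_signs !emptyE; try by case=> x xK _; apply: ne; exists x.
  by rewrite !addr0 /chib; case: asboolP => // -[].
have neE b : (exists2 x, sign_cell K s x & rsg (affine_form i x) = b) ->
    chib (i |: K) (upd s i b) =
    if `[< bounded_cell (i |: K) (upd s i b) >] then
      (-1) ^+ (normals_rank (i |: K) +
                 normals_rank (zero_indices (i |: K) (upd s i b))) else 0.
  move=> [x xK xi]; rewrite /chib; congr (if _ then _ else _).
  by apply: asbool_equiv_eq; split=> [[]|h] //; split=> //; exists x; apply/cell_upd.
have bE : chib K s = if `[< bounded_cell K s >]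
    then (-1) ^+ (normals_rank K + normals_rank (zero_indices K s)) else 0.
  rewrite /chib; congr (if _ then _ else _).
  by apply: asbool_equiv_eq; split=> [[]|h] //; split=> //; exists x0.
have lin_in v : (u i <= normals K)%MS -> lineality K v -> lineality (i |: K) v.
  by move=> iN vK; apply/linealityU1; split=> //; exact: normals_dot0 iN vK.
have [[a [ha aN]]|[iN h]] := cell_trichotomy i x0K.
  (* The cell is invariant under its lineality space, along which a form of constant sign cannot
     vary. *)
  have iNK : (u i <= normals K)%MS.
    apply/negPn/negP => /normals_dual[v [vK vi]].
    apply: (@rsg_line R a (affine_form i x0)) => t; rewrite -[t]mulr1 -vi -evD ha //.
    by rewrite -[t *: v]scale1r; apply: cell_ray => //; exact: lineality_recession.
  have -> : \sum_b chib (i |: K) (upd s i b) = chib (i |: K) (upd s i a).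
    rewrite (bigD1 a) //= big1 ?addr0 // => b ba; apply: emptyE => -[x xK xb].
    by move: ba; rewrite -xb ha // eqxx.
  rewrite bE neE; last by exists x0 => //; exact: ha.
  have weak v : recession K s v -> weak_sign a (dot (u i) v).
    move=> vK; apply: (@rsg_ray R a (affine_form i x0)) => t t0.
    by rewrite -evD ha //; exact: cell_ray.
  have -> : `[< bounded_cell (i |: K) (upd s i a) >] = `[< bounded_cell K s >].
    apply: asbool_equiv_eq; split=> hb v.
      move=> vK; have [|_ //] := (linealityU1 K i v).1 (hb v _).
      by apply/recession_upd => //; split=> //; exact: weak.
    by move=> /(recession_upd _ _ _ iK)[vK _]; apply: lin_in => //; exact: hb.
  rewrite (rkU1_in iNK) rk_zeros_upd //.
  case: a aN {ha weak} => [a _|/(_ erefl) ->] /=; by rewrite addn0.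
rewrite sum_signs bE !neE //; try exact: h.
have zE b : normals_rank (zero_indices (i |: K) (upd s i b)) =
    (normals_rank (zero_indices K s) + (b == None))%N.
  by rewrite rk_zeros_upd // iN andbT.
rewrite !zE /= !addn0 addn1.
have [iNK|iNK] := boolP (u i <= normals K)%MS; last first.
  rewrite (rkU1_notin iNK) addSn addnS.
  have [v [vK vi]] := normals_dual iNK.
  have unb b : b != None -> `[< bounded_cell (i |: K) (upd s i b) >] = false.
    move=> bn; apply/negbTE/asboolPn => hb.
    pose t : R := if b == Some true then 1 else -1.
    have : lineality (i |: K) (t *: v).
      apply: hb; apply/recession_upd => //; split; first exact: lineality_recession.
      rewrite dotZr vi mulr1 /t; case: (b) bn => [[]|] //= _.
        by rewrite weak_sign_true.
      by rewrite weak_sign_false lerN10.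
    move=> /linealityU1[+ _]; rewrite dotZr vi mulr1 /t.
    by case: ifP => _ /eqP; rewrite ?oppr_eq0 oner_eq0.
  rewrite (unb (Some true) isT) (unb (Some false) isT) !addr0.
  have -> : `[< bounded_cell (i |: K) (upd s i None) >] = `[< bounded_cell K s >].
    apply: asbool_equiv_eq; split=> hb w.
      (* A multiple of the lineality direction v makes w parallel to the hyperplane without changing
         its values on K. *)
      move=> wK; pose w' := w + (- dot (u i) w) *: v.
      have : lineality (i |: K) w'.
        apply: hb; apply/recession_upd => //; split.
          move=> j jK; rewrite dotDr; apply: weak_signD; first exact: wK.
          exact: (lineality_recession s (- dot (u i) w) vK).
        by rewrite weak_sign_none /w' dotDr dotZr vi mulr1 subrr.
      move=> /linealityU1[_ lw'] j jK; have := lw' j jK.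
      by rewrite dotDr dotZr vK // mulr0 addr0.
    move=> /(recession_upd _ _ _ iK)[wK]; rewrite weak_sign_none => /eqP wi.
    by apply/linealityU1; split=> //; exact: hb.
  by rewrite !exprS !mulN1r opprK.
rewrite (rkU1_in iNK) addnS exprS mulN1r.
move: ((-1) ^+ _) => z.
have bU b : bounded_cell K s -> bounded_cell (i |: K) (upd s i b).
  by move=> hb v /(recession_upd _ _ _ iK)[vK _]; apply: lin_in => //; exact: hb.
case: asboolP => hb.
  by do 3!(rewrite (asboolT (bU _ hb))); rewrite addKr.
have [v [vK vL]] : exists v, recession K s v /\ ~ lineality K v.
  apply: contrapT => hv; apply: hb => v vK; apply: contrapT => vL.
  by apply: hv; exists v.
have unb b : weak_sign b (dot (u i) v) ->
    `[< bounded_cell (i |: K) (upd s i b) >] = false.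
  move=> bv; apply/negbTE/asboolPn => hb'.
  have /linealityU1[_ //] : lineality (i |: K) v.
  by apply: hb'; apply/recession_upd.
have side b : ~~ weak_sign (Some b) (dot (u i) v) ->
    `[< bounded_cell (i |: K) (upd s i (Some b)) >] =
    `[< bounded_cell (i |: K) (upd s i None) >].
  move=> nb; apply: asbool_equiv_eq; split=> hb' w /(recession_upd _ _ _ iK)[wK wi].
    apply: hb'; apply/recession_upd => //; split=> //.
    by rewrite /weak_sign; move: wi; rewrite weak_sign_none => ->.
  have [wi0|wi0] := eqVneq (dot (u i) w) 0.
    by apply: hb'; apply/recession_upd => //; split=> //; rewrite weak_sign_none wi0.
  (* As v and w point to opposite sides, p w + q v is a recession direction of the wall, hence
     lineality. Its two terms have the same weak sign on each form of K, so both vanish there, and v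
     would be lineality as well. *)
  pose p := `|dot (u i) v|; pose q := `|dot (u i) w|.
  have p0 : 0 < p.
    by rewrite normr_gt0; apply: contra nb => /eqP ->; rewrite /weak_sign eqxx.
  have q0 : 0 < q by rewrite normr_gt0.
  have zrec : recession K s (p *: w + q *: v).
    move=> j jK; rewrite dotDr !dotZr; apply: weak_signD.
      by apply: weak_signM; [exact: ltW|exact: wK].
    by apply: weak_signM; [exact: ltW|exact: vK].
  have : lineality (i |: K) (p *: w + q *: v).
    apply: hb'; apply/recession_upd => //; split=> //.
    rewrite weak_sign_none dotDr !dotZr /p /q.
    case: (b) nb wi wi0 => nb wi wi0.
      rewrite weak_sign_true -ltNge in nb; rewrite weak_sign_true in wi.
      by rewrite (ltr0_norm nb) (ger0_norm wi); apply/eqP; ring.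
    rewrite weak_sign_false -ltNge in nb; rewrite weak_sign_false in wi.
    by rewrite (gtr0_norm nb) (ler0_norm wi); apply/eqP; ring.
  move=> /linealityU1[_ zl]; case: vL => j jK.
  have := zl j jK; rewrite dotDr !dotZr => /(@weak_signD_eq0 _ (s j)).
  case=> [||_ /eqP]; last by rewrite mulf_eq0 (gt_eqF q0) /= => /eqP.
    by apply: weak_signM; [exact: ltW|exact: wK].
  by apply: weak_signM; [exact: ltW|exact: vK].
case: (ltrgtP (dot (u i) v) 0) => vi.
- rewrite (unb (Some false)) ?weak_sign_false ?ltW //= addr0.
  rewrite (side true) ?weak_sign_true -?ltNge //.
  by case: ifP => _; rewrite ?addNr ?addr0.
- rewrite (unb (Some true)) ?weak_sign_true ?ltW //= add0r.
  rewrite (side false) ?weak_sign_false -?ltNge //.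
  by case: ifP => _; rewrite ?addNr ?addr0.
- by rewrite !unb /= ?addr0 // /weak_sign vi eqxx.
Qed.

Definition agree K s s' : bool := [forall i in K, s' i == s i].

(** Shared by [chi] and [chib]: invariance under one cut gives the value of a cell as the sum over
    the cells of the full arrangement inside it, by induction on the number of hyperplanes outside
    K. *)
Lemma sum_extensions (V : nmodType) (F : {set 'I_m} -> {ffun 'I_m -> option bool} -> V) :
  (forall K s i, i \notin K -> F K s = \sum_a F (i |: K) (upd s i a)) ->
  forall K s, F K s = \sum_(s' | agree K s s') F finset.setT s'.
Proof.
move=> Fcut K s; have [k] := ubnP #|~: K|; elim: k K s => // k IH K s kK.
have [KT|[i iK]] := set_0Vmem (~: K).
  have {}KT : K = finset.setT by rewrite -[K]finset.setCK KT finset.setC0.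
  rewrite KT (big_pred1 s) // => s' /=; apply/forall_inP/eqP => [h|-> //].
  by apply/ffunP => i; apply/eqP/h; rewrite inE.
rewrite inE in iK; rewrite (Fcut K s i iK).
rewrite [RHS](partition_big (fun s' => s' i) xpredT) //=.
apply: eq_bigr => a _; rewrite IH; last first.
  rewrite ltnS in kK; apply: leq_trans kK; apply: proper_card.
  apply/properP; split; first by rewrite finset.setCS subsetUr.
  by exists i; rewrite !inE ?iK ?eqxx.
apply: eq_bigl => s'; apply/forall_inP/andP => [h|[/forall_inP h /eqP hi] j].
  split; last by have := h i; rewrite ffunE eqxx !inE eqxx; apply.
  apply/forall_inP => j jK; have := h j; rewrite ffunE !inE jK orbT.
  by case: (eqVneq j i) => [ji|_]; [rewrite ji (negPf iK) in jK|apply].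
by rewrite ffunE !inE; case: (eqVneq j i) => [->|_] /=; [rewrite hi|move/h].
Qed.

End Cells.

(** * Consequences of essentiality *)

Section Essential.
Variables (R : realType) (n : nat) (A : arrangement R n).
Hypothesis ess : essential A.
Implicit Types v : 'rV[R]_n.

Lemma rk_setT : normals_rank (A := A) finset.setT = n.
Proof.
apply/eqP; rewrite eqn_leq rk_le /=.
move: ess; rewrite /essential /row_full => /eqP rkn.
rewrite -[X in (X <= _)%N]rkn; apply: mxrankS; apply/row_subP => i.
by rewrite rowK; apply: normals_sub; rewrite inE.
Qed.

Lemma lineality_setT v : lineality (A := A) finset.setT v -> v = 0.
Proof.
move=> vL; have full : row_full (normals (A := A) finset.setT).
  by rewrite /row_full -/(normals_rank _) rk_setT.
have v0 w : dot w v = 0.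
  by apply: (@normals_dot0 _ _ A finset.setT) => //; exact: submx_full.
apply/matrixP => i j; rewrite !ord1 mxE.
have := v0 (delta_mx 0 j); rewrite /dot (bigD1 j) //= big1 => [|k kj].
  by rewrite mxE !eqxx mul1r addr0.
by rewrite mxE (negPf kj) andbF mul0r.
Qed.

End Essential.

(** * Sign vectors *)

Section Rank.
Variables (T : finType) (le : rel T) (d : T -> nat) (bot : T).
Hypothesis le_trans : transitive le.
Hypothesis le_refl : reflexive le.
Hypothesis d_lt : forall x y, le x y -> x != y -> (d x < d y)%N.
Hypothesis bot_le : forall x, le bot x.
Hypothesis d_bot : d bot = 0%N.
Hypothesis dense : forall x y, le x y -> (d x + 2 <= d y)%N ->
  exists z, [/\ le x z, le z y, z != x & z != y].

(** [rank] is a longest chain length. Strict monotonicity makes d injective on a chain, which bounds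
    its length; conversely, by density an element below y of largest d lies exactly one level lower,
    which allows induction. *)
Lemma rankE y : rank le y = d y.
Proof.
apply/eqP; rewrite eqn_leq; apply/andP; split.
  apply/bigmax_leqP => C /andP[/forall_inP chC /forall_inP Cy].
  rewrite -[X in (_ <= X)%N](size_iota 0) cardE -(size_map d).
  apply: uniq_leq_size.
    rewrite map_inj_in_uniq ?enum_uniq // => x z; rewrite !mem_enum => xC zC dxz.
    apply/eqP; apply/negPn/negP => xz.
    have /forall_inP/(_ z zC)/orP[/d_lt/(_ xz)|/d_lt] := chC x xC.
      by rewrite dxz ltnn.
    by rewrite eq_sym xz dxz ltnn => /(_ isT).
  move=> k /mapP[x]; rewrite mem_enum => xC ->; rewrite mem_iota add0n /=.
  by have /andP[xy lexy] := Cy x xC; exact: d_lt.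
suff [C [chC Cy <-]] : exists C : {set T}, [/\ chain le C,
    [forall x in C, (x != y) && le x y] & #|C| = d y].
  by rewrite /rank; apply: (@leq_bigmax_cond _ _ (fun C : {set T} => #|C|) C);
    rewrite chC.
have [k] := ubnP (d y); elim: k y => // k IH y dyk.
have [y0|y0] := posnP (d y).
  exists finset.set0; rewrite cards0 y0; split=> //.
    by apply/forall_inP => x; rewrite inE.
  by apply/forall_inP => x; rewrite inE.
have by_ : (bot != y) && le bot y.
  by rewrite bot_le andbT; apply: contraTneq y0 => <-; rewrite d_bot.
case: (@arg_maxnP T bot (fun x => (x != y) && le x y) d by_) => x /andP[xy lexy] xmax.
have dxy := d_lt lexy xy.
have dxE : d y = (d x).+1.
  case: (ltnP (d x).+1 (d y)) => [h|]; last by lia.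
  have [|z [lexz lezy zx zy]] := dense lexy; first by rewrite addn2.
  have h2 : (d z <= d x)%N by apply: xmax; rewrite zy.
  by have := d_lt lexz; rewrite eq_sym zx ltnNge h2 => /(_ isT).
have [|C [chC /forall_inP Cx cC]] := IH x; first by rewrite -ltnS -dxE.
have xC : x \notin C by apply/negP => /Cx; rewrite eqxx.
exists (x |: C); rewrite cardsU1 xC cC add1n dxE; split=> //.
  apply/forall_inP => z zC; apply/forall_inP => t tC.
  move: zC tC; rewrite !inE => /orP[/eqP->|zC] /orP[/eqP->|tC].
  - by rewrite le_refl.
  - by have /andP[_ ->] := Cx t tC; rewrite orbT.
  - by have /andP[_ ->] := Cx z zC.
  - by have /forall_inP/(_ z zC)/forall_inP/(_ t tC) := chC.
apply/forall_inP => z; rewrite !inE => /orP[/eqP->|zC]; first by rewrite xy.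
have /andP[zx lezx] := Cx z zC; rewrite (le_trans lezx lexy) andbT.
apply/eqP => zy; have := d_lt lezx zx; rewrite zy; rewrite ltnNge ltnW //.
Qed.

End Rank.

(** The ratio test of linear programming: among the constraints that the motion along g violates,
    the one with the smallest quotient |f| / |g| is met first. It serves both for points, with f the
    affine forms, and for directions, with f their linear parts. *)
Lemma first_exit (R : realType) (I : finType) (K : {set I}) (t : I -> option bool)
    (f g : I -> R) (i0 : I) :
  (forall i, i \in K -> weak_sign (t i) (f i)) ->
  (forall i, i \in K -> t i = None -> g i = 0) ->
  i0 \in K -> ~~ weak_sign (t i0) (g i0) ->
  exists r i1, [/\ 0 <= r, i1 \in K, ~~ weak_sign (t i1) (g i1),
    f i1 + r * g i1 = 0 & forall i, i \in K -> weak_sign (t i) (f i + r * g i)].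
Proof.
move=> fK gK i0K bad0.
pose P i := (i \in K) && ~~ weak_sign (t i) (g i).
have P0 : P i0 by rewrite /P i0K.
have gn0 i : P i -> 0 < `|g i|.
  by case/andP=> _; rewrite normr_gt0; apply: contra => /eqP ->; rewrite /weak_sign eqxx.
case: (@arg_minP _ _ _ i0 P (fun i => `|f i| / `|g i|) P0) => i1 P1 min1.
have /andP[i1K bad1] := P1.
exists (`|f i1| / `|g i1|), i1.
set r := _ / _.
have r0 : 0 <= r by rewrite divr_ge0.
have main i : P i -> weak_sign (t i) (f i + r * g i) /\
    (`|f i| = r * `|g i| -> f i + r * g i = 0).
  move=> Pi; have /andP[iK bad] := Pi.
  have rle : r * `|g i| <= `|f i| by rewrite -ler_pdivlMr ?gn0 // min1.
  have := fK i iK; have := gK i iK; case: (t i) bad => [[]|] bad.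
  - rewrite !weak_sign_true in bad *; rewrite -ltNge in bad => _ fi.
    by rewrite (ltr0_norm bad) (ger0_norm fi) in rle *; split=> [|h]; lra.
  - rewrite !weak_sign_false in bad *; rewrite -ltNge in bad => _ fi.
    by rewrite (gtr0_norm bad) (ler0_norm fi) in rle *; split=> [|h]; lra.
  - by move=> /(_ erefl) g0; rewrite weak_sign_none g0 eqxx in bad.
split=> //.
  by apply: (main i1 P1).2; rewrite divfK // gt_eqF // gn0.
move=> i iK; have [Pi|] := boolP (P i); first exact: (main i Pi).1.
rewrite /P iK /= negbK => wi; apply: weak_signD; first exact: fK.
exact: weak_signM.
Qed.

Section SignVectors.
Variables (R : realType) (n : nat) (A : arrangement R n).
Hypothesis ess : essential A.
Let m := size_arr A.
Let u (i : 'I_m) : 'rV[R]_n := normal_vec i.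
Local Notation V := 'rV[R]_n.
Local Notation ev := (@affine_form R n A).
Local Notation cell s := (@sign_cell R n A finset.setT s).
Local Notation zeros := (@zero_indices R n A finset.setT).
Local Notation realized := (@nonempty_cell R n A finset.setT).
Local Notation bounded := (@bounded_cell R n A finset.setT).
Local Notation rk := (@normals_rank R n A).
Implicit Types (x y v w : V) (s t r : {ffun 'I_m -> option bool}) (J : {set 'I_m}).

Definition sgn_le s t : bool := [forall i, (s i == None) || (s i == t i)].

Definition sign_vector x : {ffun 'I_m -> option bool} := [ffun i => rsg (ev i x)].

Lemma cell_sign_vector x s : cell s x <-> sign_vector x = s.
Proof.
split=> [xs|<- i _]; last by rewrite ffunE.
by apply/ffunP => i; rewrite ffunE xs ?inE.
Qed.

Lemma in_zeros s i : (i \in zeros s) = (s i == None).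
Proof. by rewrite !inE. Qed.

Lemma realized_sign_vector x : realized (sign_vector x).
Proof. by exists x; apply/cell_sign_vector. Qed.

(** Keep the hyperplanes of J as equations and those not containing the cell s as strict
    inequalities. The resulting cell has zero set J, and inserting the other hyperplanes divides it
    into the faces t above s lying in all hyperplanes of J. *)
Lemma euler_local J s : realized s -> J \subset zeros s ->
  \sum_(t | `[< realized t >] && sgn_le s t && (J \subset zeros t))
    (-1) ^+ rk (zeros t) = (-1) ^+ rk J :> int.
Proof.
move=> [x xs] Js; pose K := J :|: ~: zeros s.
have zK : zero_indices K s = J.
  apply/setP => i; rewrite !inE.
  have [iJ|iJ] := boolP (i \in J); last by case: (s i).
  by have := subsetP Js i iJ; rewrite in_zeros => ->.
have chiK : chi K s = (-1) ^+ rk J.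
  rewrite /chi zK asboolT //; by exists x => i _; apply: xs; rewrite inE.
rewrite -chiK (sum_extensions (@chi_cut R n A)) [RHS]big_mkcond [LHS]big_mkcond.
apply: eq_bigr => t _; rewrite /chi.
case: asboolP => [tr|_] /=; last by case: ifP.
congr (if _ then _ else _); rewrite /=; apply/idP/idP.
  move=> /andP[/forallP st /subsetP Jt]; apply/forall_inP => i.
  rewrite !inE => /orP[iJ|si].
    have := Jt i iJ; have := subsetP Js i iJ; rewrite !in_zeros.
    by move=> /eqP -> /eqP ->.
  by have /orP[h|/eqP ->] := st i; rewrite ?h // in si.
move=> /forall_inP h; apply/andP; split.
  apply/forallP => i; case: (boolP (s i == None)) => //= si.
  by rewrite eq_sym h // !inE si orbT.
apply/subsetP => i iJ; rewrite in_zeros (eqP (h i _)) ?inE ?iJ //.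
by have := subsetP Js i iJ; rewrite in_zeros.
Qed.

(** Inserted into the flat of J, the hyperplanes divide it into all its cells: [chi] counts them all
    and [chib] only the bounded ones, whence the difference. *)
Lemma euler_unbounded J x : (forall i, i \in J -> ev i x = 0) ->
  \sum_(t | `[< realized t /\ ~ bounded t >] && (J \subset zeros t))
    (-1) ^+ (n + rk (zeros t)) = (-1) ^+ (n + rk J) - 1 :> int.
Proof.
move=> xJ; pose s : {ffun 'I_m -> option bool} := [ffun=> None].
have zJ : zero_indices J s = J.
  by apply/setP => i; rewrite !inE ffunE eqxx andbT.
have xs : sign_cell J s x by move=> i iJ; rewrite ffunE; apply/rsg_none/xJ.
have chiJ : chi J s = (-1) ^+ rk J by rewrite /chi zJ asboolT //; exists x.
(* A flat is its own lineality space up to translation, hence bounded in the relative sense and of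
   relative dimension 0. *)
have chibJ : chib J s = 1.
  rewrite /chib zJ asboolT; first by rewrite addnn -mul2n exprM sqrrN !expr1n.
  split; first by exists x.
  by move=> v vJ i iJ; have := vJ i iJ; rewrite ffunE weak_sign_none => /eqP.
rewrite exprD -chiJ -[X in _ - X]chibJ (sum_extensions (@chi_cut R n A)).
rewrite (sum_extensions (@chib_cut R n A)) mulr_sumr -sumrB.
rewrite [RHS]big_mkcond [LHS]big_mkcond; apply: eq_bigr => t _.
have -> : (J \subset zeros t) = agree J s t.
  apply/subsetP/forall_inP => h i /h; rewrite in_zeros ffunE //.
case: ifP => [/andP[/asboolP[tr tb] ->]|].
  rewrite /chi /chib asboolT // asboolF ?subr0 -?exprD //; by case.
case: ifP => // _; rewrite andbT => /negbT/asboolPn h.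
rewrite /chi /chib (rk_setT ess) exprD.
have [tr|tr] := EM (realized t).
  rewrite !asboolT ?subrr //; split=> //.
  by apply: contrapT => tb; apply: h.
by rewrite !asboolF ?mulr0 ?subrr //; case.
Qed.

Lemma sgn_le_zeros s t : sgn_le s t -> zeros t \subset zeros s.
Proof.
move=> /forallP st; apply/subsetP => i; rewrite !in_zeros => /eqP ti.
by have := st i; rewrite ti orbb.
Qed.

Lemma sgn_le_refl s : sgn_le s s.
Proof. by apply/forallP => i; rewrite eqxx orbT. Qed.

Lemma sgn_le_trans s t r : sgn_le s t -> sgn_le t r -> sgn_le s r.
Proof.
move=> /forallP st /forallP tr; apply/forallP => i.
by have /orP[->//|/eqP ->] := st i; exact: tr.
Qed.

Lemma sgn_le_unbounded s t : sgn_le s t -> ~ bounded s -> ~ bounded t.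
Proof.
move=> /forallP st sb tb; apply: sb => v vs; apply: tb => i iT.
have := vs i iT; have /orP[/eqP ->|/eqP -> //] := st i.
by rewrite weak_sign_none /weak_sign => ->.
Qed.

(** With equal ranks, a form vanishing on s has its normal spanned by those vanishing on t. These
    kill y - x, so the form vanishes on t too and s = t. *)
Lemma sgn_lt_rk s t : realized s -> realized t -> sgn_le s t -> s != t ->
  (rk (zeros t) < rk (zeros s))%N.
Proof.
move=> [x xs] [y yt] st neq; rewrite ltn_neqAle rkS ?sgn_le_zeros // andbT.
apply: contra neq => /eqP rkE; apply/eqP/ffunP => i.
have /orP[/eqP si|/eqP //] := forallP st i.
have full : (normals (zeros s) <= normals (zeros t))%MS.
  have [_ <-] := mxrank_leqif_sup (normalsS (sgn_le_zeros st)).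
  by rewrite -/(rk _) -/(rk _) rkE.
have iN : (u i <= normals (zeros t))%MS.
  by apply: submx_trans full; apply: normals_sub; rewrite in_zeros si.
have dE j : dot (u j) (y - x) = ev j y - ev j x.
  by rewrite /affine_form -(scaleN1r x) dotDr dotZr; ring.
have := normals_dot0 (v := y - x) iN; rewrite dE => h.
rewrite -(xs i) ?inE // -(yt i) ?inE //; congr rsg.
suff : ev i y - ev i x = 0 by move/eqP; rewrite subr_eq0 => /eqP.
apply: h => j jt; rewrite -/(u j) dE.
by rewrite (cell_zeros yt) // (cell_zeros xs) ?subrr // (subsetP (sgn_le_zeros st)).
Qed.

Lemma rk_lt_ex J (K : {set 'I_m}) : (rk J < rk K)%N ->
  exists2 i, i \in K & ~~ (u i <= normals J)%MS.
Proof.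
move=> JK; apply: contrapT => h; move: JK; rewrite ltnNge => /negP; apply.
apply: mxrankS; apply: normals_subP => i iK; apply/negPn/negP => iJ.
by apply: h; exists i.
Qed.

Lemma notin_normals_zeros s i : ~~ (u i <= normals (zeros s))%MS -> s i != None.
Proof. by apply: contra => si; apply: normals_sub; rewrite in_zeros. Qed.

Lemma small_move x v : exists2 e, 0 < e &
  forall i, ev i x != 0 -> rsg (ev i (x + e *: v)) = rsg (ev i x).
Proof.
have [|e e0 he] := @common_radius R 'I_m
    (fun i z => ev i x != 0 -> rsg (ev i (x + z *: v)) = rsg (ev i x)).
  move=> i; have [->|xi] := eqVneq (ev i x) 0; first by exists 1.
  have [|e e0 he] := @rsg_stable R (ev i x) (dot (u i) v).
    by move/rsg_none => h; rewrite h eqxx in xi.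
  by exists e => // r re _; rewrite evD he.
by exists e => // i; apply: he; rewrite gtr0_norm.
Qed.

(** Far along v the linear part dominates. Dividing by the length z = 1 / e turns this into
    stability of the sign of the linear part under a small perturbation. *)
Lemma large_move x v : exists2 z, 0 < z &
  forall i, rsg (ev i (x + z *: v)) =
    if dot (u i) v == 0 then rsg (ev i x) else rsg (dot (u i) v).
Proof.
have [|e e0 he] := @common_radius R 'I_m
    (fun i z => dot (u i) v != 0 -> rsg (dot (u i) v + z * ev i x) = rsg (dot (u i) v)).
  move=> i; have [->|vi] := eqVneq (dot (u i) v) 0; first by exists 1.
  have [|e e0 he] := @rsg_stable R (dot (u i) v) (ev i x).
    by move/rsg_none => h; rewrite h eqxx in vi.
  by exists e => // r re _; rewrite he.
exists e^-1 => [|i]; first by rewrite invr_gt0.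
rewrite evD; case: eqVneq => [->|vi]; first by rewrite mulr0 addr0.
rewrite -(he i e) ?gtr0_norm //.
have -> : dot (u i) v + e * ev i x = e * (ev i x + e^-1 * dot (normal_vec i) v).
  by rewrite [RHS]mulrDr mulVKf ?gt_eqF // addrC.
by rewrite /rsg mulf_eq0 (gt_eqF e0) /= pmulr_rgt0.
Qed.

Lemma weak_rsg a (z : R) : weak_sign a z -> (rsg z == None) || (rsg z == a).
Proof. by rewrite /weak_sign => /orP[/eqP ->|->]; rewrite ?orbT // /rsg eqxx. Qed.

Lemma weak_of_rsg a (z : R) : rsg z = a -> weak_sign a z.
Proof. by rewrite /weak_sign => ->; rewrite eqxx orbT. Qed.

(** A direction parallel to the cell and to hyperplane i1 that leaves the side of s at i2: following
    it reaches a new wall while form i1 keeps its value, which keeps the constructions below from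
    degenerating. The sign is chosen against [s i2]. *)
Lemma leaving_direction s i1 (K : {set 'I_m}) :
  (rk (i1 |: zeros s) < rk K)%N ->
  exists i2 w, [/\ i2 \in K, ~~ weak_sign (s i2) (dot (u i2) w),
    dot (u i1) w = 0 & forall j, s j = None -> dot (u j) w = 0].
Proof.
move=> /rk_lt_ex[i2 i2K i2N].
have [w [wJ wi2]] := normals_dual i2N.
have i2s : s i2 != None.
  apply: notin_normals_zeros; apply: contra i2N => h; apply: submx_trans h _.
  by apply: normalsS; exact: subsetUr.
exists i2, ((if s i2 == Some true then -1 else 1) *: w); split=> //.
- rewrite dotZr wi2 mulr1; case: (s i2) i2s => [[]|] //= _.
    by rewrite weak_sign_true -ltNge ltrN10.
  by rewrite weak_sign_false -ltNge ltr01.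
- by rewrite dotZr wJ ?mulr0 // !inE eqxx.
- by move=> j sj; rewrite dotZr wJ ?mulr0 // !inE sj eqxx orbT.
Qed.

(** The point g of t moves along w to the first wall i3 among [zeros s], giving q. A small step from
    p towards q has the signs of q on [zeros s] and those of s elsewhere. The result differs from t
    at i3, and from s at i1, where q keeps the value of g. *)
Lemma sgn_between s t : realized s -> realized t -> sgn_le s t ->
  (rk (zeros t) + 2 <= rk (zeros s))%N ->
  exists r, [/\ realized r, sgn_le s r, sgn_le r t, r != s & r != t].
Proof.
clear ess; move=> [p ps] [g gt_] st gap.
have [|i1 i1s i1N] := @rk_lt_ex (zeros t) (zeros s); first by lia.
have t1 := notin_normals_zeros i1N.
have [|i2 [w [i2s bad2 w1 wt]]] := @leaving_direction t i1 (zeros s).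
  by rewrite rkU1_notin //; lia.
have [|| z [i3 [z0 i3s bad3 ex3 weak]]] := @first_exit R 'I_m (zeros s) t
    (fun i => ev i g) (fun i => dot (u i) w) i2 _ _ i2s bad2.
- by move=> i _; apply: weak_of_rsg; rewrite gt_ ?inE.
- by move=> i _; exact: wt.
pose q := g + z *: w.
have qE i : ev i q = ev i g + z * dot (u i) w by rewrite evD.
have [e e0 he] := small_move p (q - p).
have dE i : dot (u i) (q - p) = ev i q - ev i p.
  by rewrite /affine_form -(scaleN1r p) dotDr dotZr; ring.
have zE i : i \in zeros s -> ev i (p + e *: (q - p)) = e * ev i q.
  by move=> iz; rewrite evD dE (cell_zeros ps iz); ring.
have rsgM (c : R) : rsg (e * c) = rsg c.
  by rewrite /rsg mulf_eq0 (gt_eqF e0) /= pmulr_rgt0.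
have nzE i : s i != None -> sign_vector (p + e *: (q - p)) i = s i.
  rewrite ffunE -(ps i) ?inE // => h; apply: he.
  by apply: contra h => /eqP ->; rewrite /rsg eqxx.
exists (sign_vector (p + e *: (q - p))); split.
- exact: realized_sign_vector.
- by apply/forallP => i; case: (boolP (s i == None)) => //= si; rewrite nzE.
- apply/forallP => i; case: (boolP (s i == None)) => si.
    have iz : i \in zeros s by rewrite in_zeros.
    by rewrite ffunE zE // rsgM qE; apply: weak_rsg; exact: weak.
  by rewrite nzE //; exact: (forallP st).
- apply/eqP => /ffunP/(_ i1); rewrite ffunE zE // rsgM qE w1 mulr0 addr0 gt_ ?inE //.
  by move=> h; move: i1s t1; rewrite in_zeros -h => ->.
- apply/eqP => /ffunP/(_ i3); rewrite ffunE zE // rsgM qE ex3 => h.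
  by move: bad3; rewrite -h /rsg eqxx weak_sign_none wt ?eqxx // -h /rsg eqxx.
Qed.

Lemma sgn_bump s : realized s -> (0 < rk (zeros s))%N ->
  exists t, [/\ realized t, sgn_le s t & t != s].
Proof.
move=> [p ps] s0.
have [|i i_s iN] := @rk_lt_ex finset.set0 (zeros s).
  by rewrite /rk /normals big_set0 mxrank0.
have [v [_ vi]] := normals_dual iN.
have [e e0 he] := small_move p v.
exists (sign_vector (p + e *: v)); split.
- exact: realized_sign_vector.
- apply/forallP => j; case: (boolP (s j == None)) => //= sj.
  rewrite ffunE he ?ps ?inE //; apply: contra sj => /eqP pj.
  by rewrite -(ps j) ?inE // pj /rsg eqxx.
- apply/eqP => /ffunP/(_ i); rewrite ffunE evD vi mulr1 (cell_zeros ps i_s) add0r.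
  move: i_s; rewrite in_zeros => /eqP -> /rsg_none e00.
  by rewrite e00 ltxx in e0.
Qed.

Lemma unbounded_large_move x v i : dot (u i) v != 0 ->
  exists2 r, realized r /\ ~ bounded r & forall j, r j =
    if dot (u j) v == 0 then rsg (ev j x) else rsg (dot (u j) v).
Proof.
move=> vi; have [z z0 hr] := large_move x v.
exists (sign_vector (x + z *: v)); last by move=> j; rewrite ffunE hr.
split; first exact: realized_sign_vector.
move=> /(_ v) h; move/eqP: vi; apply; apply: h; last by rewrite inE.
move=> j _; rewrite ffunE hr; case: eqVneq => [->|_]; first by rewrite /weak_sign eqxx.
exact: weak_of_rsg.
Qed.

Lemma ex_unbounded : (0 < n)%N -> exists s, realized s /\ ~ bounded s.
Proof.
move=> n0; have [|i _ iN] := @rk_lt_ex finset.set0 finset.setT.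
  by rewrite (rk_setT ess) /rk /normals big_set0 mxrank0.
have [v [_ vi]] := normals_dual iN.
have [|r hr _] := @unbounded_large_move 0 v i; last by exists r.
by rewrite vi oner_eq0.
Qed.

(** Two exits along the same w. First the recession direction v moves to v', parallel to a new
    hyperplane i3; it stays nonzero because w is parallel to i1. Then, among the hyperplanes
    parallel to v', g moves to a wall i4, an exit being guaranteed by i3. Far along v' lies the
    required face: v' decides the signs on the other hyperplanes, and i4 is a new zero. *)
Lemma unbounded_below t : realized t -> ~ bounded t ->
  (rk (zeros t) + 2 <= n)%N ->
  exists r, [/\ realized r, ~ bounded r, sgn_le r t & r != t].
Proof.
move=> [g gt_] tb gap.
have [v [vt [i1 v1]]] : exists v, recession finset.setT t v /\
    exists i, dot (u i) v != 0.
  apply: contrapT => h; apply: tb => v vt i _; apply/eqP/negPn/negP => vi.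
  by apply: h; exists v; split=> //; exists i.
have vz j : t j = None -> dot (u j) v = 0.
  by move=> tj; have := vt j (finset.in_setT _); rewrite tj weak_sign_none => /eqP.
have i1N : ~~ (u i1 <= normals (zeros t))%MS.
  apply: contra v1 => h; apply/eqP; apply: normals_dot0 h _ => j.
  by rewrite in_zeros => /eqP; exact: vz.
have [|i2 [w [_ bad2 w1 wt]]] := @leaving_direction t i1 finset.setT.
  by rewrite rkU1_notin // (rk_setT ess); lia.
have [|| z [i3 [z0 _ bad3 ex3 weak]]] := @first_exit R 'I_m finset.setT t
    (fun i => dot (u i) v) (fun i => dot (u i) w) i2 _ _ (finset.in_setT _) bad2.
- by move=> i iT; exact: vt.
- by move=> i _; exact: wt.
pose v' := v + z *: w.
have vE i : dot (u i) v' = dot (u i) v + z * dot (u i) w by rewrite dotDr dotZr.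
pose K : {set 'I_m} := finset (fun i => dot (u i) v' == 0).
have i3K : i3 \in K by rewrite inE vE ex3.
have [|| z' [i4 [z0' i4K bad4 ex4 weak']]] := @first_exit R 'I_m K t
    (fun i => ev i g) (fun i => dot (u i) w) i3 _ _ i3K bad3.
- by move=> i _; apply: weak_of_rsg; rewrite gt_ ?inE.
- by move=> i _; exact: wt.
have [|s [sr sb] sE] := @unbounded_large_move (g + z' *: w) v' i1.
  by rewrite vE w1 mulr0 addr0.
exists s; split=> //.
  apply/forallP => i; rewrite sE; case: (eqVneq (dot (u i) v') 0) => [vi|vi].
    by rewrite evD; apply: weak_rsg; apply: weak'; rewrite inE vi.
  by apply: weak_rsg; rewrite vE; apply: weak; rewrite inE.
apply/eqP => /ffunP/(_ i4); rewrite sE.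
move: (i4K); rewrite inE => ->; rewrite evD ex4 => h.
by move: bad4; rewrite -h /rsg eqxx weak_sign_none wt ?eqxx // -h /rsg eqxx.
Qed.

End SignVectors.

From mathcomp Require Import all_classical all_reals.
From mathcomp Require Import topology normedtype derive.

Import numFieldNormedType.Exports.

(** * Unbounded faces and closures *)

Lemma continuous_sum (R : realType) (V : normedModType R) (I : Type) (r : seq I)
    (f : I -> V -> R) :
  (forall i, continuous (f i)) -> continuous (fun x => \sum_(i <- r) f i x).
Proof.
move=> fc; elim: r => [|i r IHr].
  rewrite (_ : (fun x => _) = cst 0); first exact: cst_continuous.
  by apply: funext => x; rewrite big_nil.
rewrite (_ : (fun x => _) = (fun x => f i x + \sum_(j <- r) f j x)).
  by move=> x; apply: cvgD; [exact: fc|exact: IHr].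
by apply: funext => x; rewrite big_cons.
Qed.

Lemma dot_continuous (R : realType) (n : nat) (u : 'rV[R]_n) :
  continuous (dot u : 'rV[R]_n -> R).
Proof.
apply: continuous_sum => j x.
apply: (@continuous_comp _ _ _ (fun x : 'rV[R]_n => x 0 j) ( *%R (u 0 j))).
  exact: coord_continuous.
exact: mulrl_continuous.
Qed.

Section Topology.
Local Open Scope classical_set_scope.
Variables (R : realType) (n : nat) (A : arrangement R n).
Let m := size_arr A.
Let u (i : 'I_m) : 'rV[R]_n := normal_vec i.
Local Notation V := 'rV[R]_n.
Local Notation ev := (@affine_form R n A).
Local Notation cell s := (@sign_cell R n A finset.setT s).
Implicit Types (x y v w : V) (s t : {ffun 'I_m -> option bool}).

Lemma ev_continuous i : continuous (ev i : V -> R).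
Proof. move=> x; apply: (@continuousB _ _ _ (dot (u i)) (fun=> offset i)).
  exact: dot_continuous.
exact: cst_continuous.
 Qed.

Lemma rsg_open (b : bool) i : open [set x | rsg (ev i x) = Some b].
Proof.
case: b.
  rewrite (_ : [set x | _] = ev i @^-1` [set r | 0 < r]).
    by apply: open_comp; [move=> x _; exact: ev_continuous|exact: open_gt].
  by apply/seteqP; split=> x /= /rsg_pos.
rewrite (_ : [set x | _] = ev i @^-1` [set r | r < 0]).
  by apply: open_comp; [move=> x _; exact: ev_continuous|exact: open_lt].
by apply/seteqP; split=> x /= /rsg_neg.
Qed.

Lemma closure_cell s t x y : cell s x -> cell t y ->
  ([set z | cell s z] `<=` closure [set z | cell t z]) <-> sgn_le s t.
Proof.
move=> xs yt; split=> [st|/forallP st z zs B].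
  apply/forallP => i; case si : (s i) => [b|] //=; rewrite eq_sym.
  have : nbhs x [set z | rsg (ev i z) = Some b].
    by apply: open_nbhs_nbhs; split; [exact: rsg_open|rewrite /= xs ?inE].
  by move=> /(st _ xs)[z [/= zt <-]]; rewrite zt ?inE.
move=> /nbhs_ballP[e /= e0 eB].
(* The bound 1 keeps the point on the segment to y; the other one puts it within e of z. *)
pose r : R := Num.min 1 (e / (`|y - z| + 1) / 2).
have D0 : 0 < `|y - z| + 1 by rewrite ltr_wpDl.
have r0 : 0 < r by rewrite /r lt_min ltr01 !divr_gt0.
have r1 : r <= 1 by rewrite /r ge_min lexx.
exists (z + r *: (y - z)); split.
  move=> i _ /=; rewrite evD.
  have -> : affine_form i z + r * dot (normal_vec i) (y - z) =
      (1 - r) * ev i z + r * ev i y.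
    have -> : dot (u i) (y - z) = ev i y - ev i z.
      by rewrite /affine_form -(scaleN1r z) dotDr dotZr; ring.
    by ring.
  have := zs i (finset.in_setT _); have := yt i (finset.in_setT _).
  have /orP[/eqP ->|/eqP ->] := st i.
    move=> yi /rsg_none ->; rewrite mulr0 add0r /rsg mulf_eq0 gt_eqF //=.
    by rewrite pmulr_rgt0.
  case: (t i) => [[]|].
  - by move=> /rsg_pos hy /rsg_pos hx; apply/rsg_pos; nra.
  - by move=> /rsg_neg hy /rsg_neg hx; apply/rsg_neg; nra.
  - by move=> /rsg_none -> /rsg_none ->; apply/rsg_none; rewrite !mulr0 addr0.
apply: eB; rewrite -ball_normE /ball_ /= opprD addrA subrr sub0r normrN normrZ.
rewrite gtr0_norm //.
have h : r <= e / (`|y - z| + 1) / 2 by rewrite /r ge_min lexx orbT.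
have qD : e / (`|y - z| + 1) * (`|y - z| + 1) = e by rewrite divfK // gt_eqF.
have q0 : 0 < e / (`|y - z| + 1) by rewrite divr_gt0.
have := normr_ge0 (y - z).
move: (e / _) h qD q0 => q; move: `|y - z| => N h qD q0 N0; nra.
Qed.

Hypothesis ess : essential A.

(** [gap s] is nonnegative, positively homogeneous, and vanishes exactly on the
    recession directions of the cell [s]. *)
Let sgr (a : option bool) : R := if a is Some b then (-1) ^+ ~~ b else 0.
Let gap s v : R := \sum_i (`|dot (u i) v| - sgr (s i) * dot (u i) v).

Let gap_term (a : option bool) (r : R) : 0 <= `|r| - sgr a * r.
Proof.
rewrite subr_ge0; apply: le_trans (ler_norm _) _; rewrite normrM.
by case: a => [[]|]; rewrite /= ?expr0 ?expr1 ?normr1 ?normrN1 ?normr0 ?mul1r ?mul0r.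
Qed.

Let gap_term_eq0 (a : option bool) (r : R) : `|r| - sgr a * r = 0 -> weak_sign a r.
Proof.
case: a => [[]|] /=; rewrite ?weak_sign_true ?weak_sign_false ?weak_sign_none.
- by rewrite mul1r => /eqP; rewrite subr_eq0 => /eqP <-.
- by rewrite mulN1r opprK => h; have := normr_ge0 r; lra.
- by rewrite mul0r subr0 => /eqP; rewrite normr_eq0.
Qed.

Let gap_continuous s : continuous (gap s).
Proof.
apply: continuous_sum => i x.
apply: (@continuousB _ _ _ (fun x => `|dot (u i) x|) (fun x => sgr (s i) * dot (u i) x)).
  apply: (@continuous_comp _ _ _ (dot (u i)) Num.norm); first exact: dot_continuous.
  exact: norm_continuous.
apply: (@continuous_comp _ _ _ (dot (u i)) ( *%R (sgr (s i)))).
  exact: dot_continuous.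
exact: mulrl_continuous.
Qed.

Let gapZ s (t : R) v : 0 <= t -> gap s (t *: v) = t * gap s v.
Proof.
move=> t0; rewrite /gap mulr_sumr; apply: eq_bigr => i _.
by rewrite dotZr normrM ger0_norm // mulrBr [sgr _ * _]mulrCA.
Qed.

(** On the cell, [gap] of y - x is bounded independently of y because y contributes |ev| - |ev| = 0.
    If the recession cone is trivial, [gap] is positive on the compact unit sphere, hence at least e
    |v| everywhere, and this bounds y - x. *)
Lemma bounded_cellP s x : cell s x ->
  bounded_cell finset.setT s <-> bounded_set [set z | cell s z].
Proof.
move=> xs; split=> [hb|[M [Mr hM]] v vrec]; last first.
  suff v0 : v = 0 by move=> i _; rewrite v0 dot0r.
  apply/eqP; apply/negPn/negP => vn0.
  have V0 : 0 < `|v| by rewrite normr_gt0.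
  (* Chosen so that x + r v has norm at least |M| + 2, beyond the bound |M| + 1. *)
  pose r : R := (`|M| + 1 + `|x| + 1) / `|v|.
  have r0 : 0 <= r by rewrite divr_ge0 // !addr_ge0.
  have /(hM (`|M| + 1) _) /= h := cell_ray r0 xs vrec.
  have {}h : `|x + r *: v| <= `|M| + 1.
    by apply: h; have := ler_norm M; lra.
  have : `|r *: v| = `|M| + 1 + `|x| + 1.
    by rewrite normrZ ger0_norm // divfK // gt_eqF.
  have := ler_normD (x + r *: v) (- x); rewrite normrN addrAC subrr add0r.
  by move=> h1 h2; lra.
have bound y : cell s y -> gap s (y - x) <= \sum_i (`|ev i x| *+ 2).
  move=> ys; apply: ler_sum => i _.
  have -> : dot (u i) (y - x) = ev i y - ev i x.
    by rewrite /affine_form -(scaleN1r x) dotDr dotZr; ring.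
  have yi : sgr (s i) * ev i y = `|ev i y|.
    have := ys i (finset.in_setT _); case: (s i) => [[]|] /=.
    - by move=> /rsg_pos h; rewrite mul1r gtr0_norm.
    - by move=> /rsg_neg h; rewrite mulN1r ltr0_norm.
    - by move=> /rsg_none ->; rewrite mul0r normr0.
  have xi : sgr (s i) * ev i x = `|ev i x|.
    have := xs i (finset.in_setT _); case: (s i) => [[]|] /=.
    - by move=> /rsg_pos h; rewrite mul1r gtr0_norm.
    - by move=> /rsg_neg h; rewrite mulN1r ltr0_norm.
    - by move=> /rsg_none ->; rewrite mul0r normr0.
  rewrite mulrBr yi xi; have := ler_normB (ev i y) (ev i x); rewrite mulr2n; lra.
set C := \sum_i _ in bound.
have [e e0 he] : exists2 e, 0 < e & forall v, e * `|v| <= gap s v.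
  pose S := [set v : V | `|v| = 1].
  have [v1|noS] := EM (S !=set0); last first.
    exists 1 => // v; rewrite mul1r.
    have [->|vn0] := eqVneq v 0.
      by rewrite normr0; apply: sumr_ge0 => i _.
    exfalso; apply: noS; exists (`|v|^-1 *: v).
    by rewrite /S /= normrZ normfV normr_id mulVf // normr_eq0.
  have Sb : bounded_set S.
    by exists 1; split=> // M M1 v /= ->; exact: ltW.
  have Sc : closed S.
    rewrite (_ : S = (fun v : V => `|v|) @^-1` [set r | r = 1]) //.
    by apply: closed_comp; [move=> z _; exact: norm_continuous|exact: closed_eq].
  have [|c /set_mem cS cmin] := EVT_min_rV v1 (bounded_closed_compact Sb Sc) (f := gap s).
    by apply: continuous_subspaceT; exact: gap_continuous.
  exists (gap s c).
    have g0 : 0 <= gap s c by apply: sumr_ge0.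
    rewrite lt_neqAle g0 andbT eq_sym; apply/eqP => gc.
    have crec : recession finset.setT s c.
      move=> i _; apply: gap_term_eq0.
      exact: (psumr_eq0P (fun j _ => gap_term (s j) (dot (u j) c)) gc).
    have /(lineality_setT ess) c0 := hb c crec.
    by move: cS; rewrite /S /= c0 normr0 => /eqP; rewrite eq_sym oner_eq0.
  move=> v; have [->|vn0] := eqVneq v 0.
    by rewrite normr0 mulr0; apply: sumr_ge0.
  have vS : `|v|^-1 *: v \in S.
    by apply/mem_set; rewrite /S /= normrZ normfV normr_id mulVf // normr_eq0.
  have := cmin _ vS; rewrite gapZ ?invr_ge0 //.
  by rewrite ler_pdivlMl ?normr_gt0 // mulrC.
exists (`|x| + C / e); split; first exact: num_real.
move=> M hM y /= ys; apply: le_trans (ltW hM).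
have : e * `|y - x| <= C by apply: le_trans (he _) (bound _ ys).
rewrite mulrC -ler_pdivlMr // => h.
have := ler_normD (y - x) x; rewrite subrK => h'; lra.
Qed.

End Topology.

(** * The lattice of flats *)

Section FsetSet.
Local Open Scope classical_set_scope.
Variables (T : choiceType) (P : set T).
Hypothesis Pfin : finite_set P.

Lemma fset_set_valP (x : fset_set P) : P (val x).
Proof. by have := fsvalP x; rewrite in_fset_set // inE. Qed.

Lemma fset_set_ex (y : T) : P y -> exists x : fset_set P, val x = y.
Proof.
move=> Py; have h : y \in fset_set P by rewrite in_fset_set // inE.
by exists [` h]%fset.
Qed.

End FsetSet.

Section Lattice.
Local Open Scope classical_set_scope.
Variables (R : realType) (n : nat) (A : arrangement R n).
Hypothesis ess : essential A.
Hypothesis nc : noncentral A.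
Let m := size_arr A.
Let u (i : 'I_m) : 'rV[R]_n := normal_vec i.
Local Notation V := 'rV[R]_n.
Local Notation ev := (@affine_form R n A).
Local Notation rk := (@normals_rank R n A).
Implicit Types (x y v w : V) (X Y Z : set V) (J K : {set 'I_m}).

(** In dimension 0 no normal is nonzero, so there is no hyperplane and the intersection is the whole
    space, not empty. *)
Lemma dim_gt0 : (0 < n)%N.
Proof.
clear ess; case: (posnP n) => // n0; suff : (\bigcap_i hyp (A := A) i) 0 by rewrite nc.
move=> i _; have := normal_vec_neq0 i.
suff -> : normal_vec i = 0 by rewrite eqxx.
by apply/matrixP => a b; have := ltn_ord b; lia.
Qed.

Lemma hypE i x : hyp i x <-> ev i x = 0.
Proof.
rewrite /hyp /hyperplane /affine_form /=; split=> [->|/eqP]; first by rewrite subrr.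
by rewrite subr_eq0 => /eqP.
Qed.

Definition flat J : set V := [set x | forall i, i \in J -> ev i x = 0].

Lemma lattice_flat X :
  intersection_lattice A X <-> exists J, X = flat J.
Proof.
split=> [[J ->]|[J ->]].
  exists (finset (fun i => `[< J i >])); apply/seteqP; split=> x /=.
    by move=> h i; rewrite inE => /asboolP/h/hypE.
  by move=> h i Ji; apply/hypE/h; rewrite inE; apply/asboolP.
exists [set i | i \in J]; apply/seteqP; split=> x /= h i iJ.
  exact/hypE/h.
exact/hypE/h.
Qed.

(** For the empty set these are all the indices, which will give the empty flat codimension n. *)
Definition hyps_of X : {set 'I_m} := finset (fun i => `[< X `<=` hyp i >]).

Lemma in_hyps_of X i : (i \in hyps_of X) <-> X `<=` hyp i.
Proof. by rewrite inE; split=> /asboolP. Qed.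

Lemma hyps_ofS X Y : X `<=` Y -> hyps_of Y \subset hyps_of X.
Proof.
by move=> XY; apply/fintype.subsetP => i /in_hyps_of Yi; apply/in_hyps_of => x /XY/Yi.
Qed.

Lemma flatS J K : J \subset K -> flat K `<=` flat J.
Proof. by move=> /fintype.subsetP JK x h i /JK; exact: h. Qed.

Lemma sub_hyps_of_flat J : J \subset hyps_of (flat J).
Proof. by apply/fintype.subsetP => i iJ; apply/in_hyps_of => x h; apply/hypE/h. Qed.

Lemma lattice_hyps_of X : intersection_lattice A X -> X = flat (hyps_of X).
Proof.
move=> /lattice_flat[J ->]; apply/seteqP; split; last first.
  by apply: flatS; exact: sub_hyps_of_flat.
by move=> x xJ i /in_hyps_of h; apply/hypE/h.
Qed.

Lemma flat_move J x v : flat J x -> (forall j, j \in J -> dot (u j) v = 0) ->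
  flat J (x + v).
Proof.
by move=> xJ vJ i iJ; rewrite -[v]scale1r evD xJ // vJ // mulr0 addr0.
Qed.

Lemma rk_hyps_of_flat J x : flat J x -> rk (hyps_of (flat J)) = rk J.
Proof.
move=> xJ; apply/eqP; rewrite eqn_leq andbC rkS ?sub_hyps_of_flat //=.
apply: mxrankS; apply: normals_subP => i /in_hyps_of iJ.
apply/negPn/negP => /normals_dual[v [vJ vi]].
have /hypE := iJ _ (flat_move xJ vJ); have /hypE := iJ _ xJ.
rewrite -[x + v]/(x + v) -[v]scale1r evD vi mulr1 => -> /eqP.
by rewrite add0r oner_eq0.
Qed.

Lemma flat_not_point J x : flat J x -> (rk J < n)%N -> ~ is_point (flat J).
Proof.
move=> xJ Jn [p pE]; have [|i _ iN] := @rk_lt_ex _ _ A J finset.setT.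
  by rewrite (rk_setT ess).
have [v [vJ vi]] := normals_dual iN.
have : flat J (x + v) by exact: flat_move.
move: xJ; rewrite pE /= => -> /eqP; rewrite -subr_eq0 addrC addKr => /eqP v0.
by move: vi; rewrite v0 dot0r => /eqP; rewrite eq_sym oner_eq0.
Qed.

Lemma full_flat_point J x : flat J x -> rk J = n -> is_point (flat J).
Proof.
move=> xJ Jn; exists x; apply/seteqP; split=> [y yJ|_ -> //] /=.
have : lineality (A := A) finset.setT (y - x).
  move=> i _; apply: (@normals_dot0 _ _ A J).
    by apply: submx_full; rewrite /row_full -/(rk J) Jn.
  move=> j jJ; have := yJ j jJ; have := xJ j jJ.
  by rewrite /affine_form -(scaleN1r x) dotDr dotZr; lra.
by move/(lineality_setT ess)/eqP; rewrite subr_eq0 => /eqP.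
Qed.

Lemma finite_Lub : finite_set [set X | intersection_lattice A X /\ ~ is_point X].
Proof.
apply: (@sub_finite_set _ _ (flat @` [set: {set 'I_m}])).
  by move=> X [/lattice_flat[J ->] _]; exists J.
by apply: finite_image; exact: finite_finset.
Qed.

Implicit Types L M : Lub A.

Lemma LubP L : intersection_lattice A (val L) /\ ~ is_point (val L).
Proof. exact: (fset_set_valP finite_Lub). Qed.

Lemma Lub_ex X : intersection_lattice A X -> ~ is_point X ->
  exists L : Lub A, val L = X.
Proof. by move=> h1 h2; exact: (fset_set_ex finite_Lub). Qed.

Lemma Lub_flat J x : flat J x -> (rk J < n)%N ->
  exists L : Lub A, val L = flat J.
Proof.
move=> xJ Jn; apply: Lub_ex; first by apply/lattice_flat; exists J.
exact: flat_not_point xJ Jn.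
Qed.

(** As points are removed, the value n is attained by the empty flat alone. *)
Definition codim L : nat := rk (hyps_of (val L)).

Lemma Lub_leP L M : Lub_le L M <-> val M `<=` val L.
Proof. by split=> /asboolP. Qed.

Lemma Lub_le_hyps L M : Lub_le L M <-> hyps_of (val L) \subset hyps_of (val M).
Proof.
split=> [/Lub_leP|h]; first exact: hyps_ofS.
apply/Lub_leP; have [+ _] := LubP L; have [+ _] := LubP M.
by move=> /lattice_hyps_of -> /lattice_hyps_of ->; exact: flatS.
Qed.

Lemma Lub_le_refl : reflexive (@Lub_le R n A).
Proof. by move=> L; apply/Lub_leP. Qed.

Lemma Lub_le_trans : transitive (@Lub_le R n A).
Proof. by move=> M L N /Lub_leP h1 /Lub_leP h2; apply/Lub_leP => x /h2/h1. Qed.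

Lemma codim_le L : (codim L <= n)%N. Proof. exact: rk_le. Qed.

Lemma codim_lt_nonempty L : (codim L < n)%N -> val L !=set0.
Proof.
move=> Ln; apply: contrapT => h; move: Ln; rewrite ltnNge => /negP; apply.
rewrite -[X in (X <= _)%N](rk_setT ess); apply: rkS; apply/fintype.subsetP => i _.
by apply/in_hyps_of => x xL; case: h; exists x.
Qed.

Lemma nonempty_codim_lt L x : val L x -> (codim L < n)%N.
Proof.
move=> xL; rewrite ltn_neqAle codim_le andbT; apply/eqP => Ln.
have [/lattice_hyps_of LE np] := LubP L; apply: np; rewrite LE.
by apply: (@full_flat_point _ x) => //; rewrite -LE.
Qed.

Lemma codim_lt L M : Lub_le L M -> L != M -> (codim L < codim M)%N.
Proof.
move=> LM neq; have LM' := (Lub_le_hyps L M).1 LM.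
rewrite ltn_neqAle rkS // andbT; apply/eqP => rkE; move/eqP: neq; apply.
apply: val_inj; apply/seteqP; split; last exact/Lub_leP.
have [[y yM]|M0] := EM (val M !=set0); last first.
  have [[x xL]|L0] := EM (val L !=set0); last by move=> x xL; case: L0; exists x.
  have := nonempty_codim_lt xL; rewrite rkE => /codim_lt_nonempty.
  by move=> h; case: M0.
apply/Lub_leP/Lub_le_hyps/fintype.subsetP => i iM; apply/in_hyps_of => x xL.
have [+ _] := LubP L; move/lattice_hyps_of => LE.
have iN : (u i <= normals (hyps_of (val L)))%MS.
  apply: submx_trans (normals_sub iM) _.
  have [_ <-] := mxrank_leqif_sup (normalsS LM').
  by apply/eqP; exact: rkE.
have yL : val L y by move/Lub_leP: LM; exact.
apply/hypE; have iy : ev i y = 0 by apply/hypE; move/in_hyps_of: iM; exact.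
have : dot (u i) (x - y) = 0.
  apply: normals_dot0 iN _ => j jL.
  have /hypE := (in_hyps_of _ _).1 jL _ xL; have /hypE := (in_hyps_of _ _).1 jL _ yL.
  by rewrite /affine_form -(scaleN1r y) dotDr dotZr; lra.
by move: iy; rewrite /affine_form -(scaleN1r y) dotDr dotZr; lra.
Qed.

(** Intersect L with a hyperplane through M whose normal is independent of those of L. Moving a
    point of L along a dual vector shows the intersection nonempty; its codimension is still below
    n, so it is not a point. *)
Lemma Lub_between L M : Lub_le L M -> (codim L + 2 <= codim M)%N ->
  exists N, [/\ Lub_le L N, Lub_le N M, N != L & N != M].
Proof.
move=> LM gap; have Mn := codim_le M.
have [x xL] : val L !=set0 by apply: codim_lt_nonempty; lia.
have [|i iM iN] := @rk_lt_ex _ _ A (hyps_of (val L)) (hyps_of (val M)).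
  by rewrite -/(codim L) -/(codim M); lia.
have [v [vL vi]] := normals_dual iN.
have [/lattice_hyps_of LE _] := LubP L.
have xL' : flat (hyps_of (val L)) x by rewrite -LE.
have rkE : rk (i |: hyps_of (val L)) = (codim L).+1 by exact: rkU1_notin.
have zF : flat (i |: hyps_of (val L)) (x + (- ev i x) *: v).
  move=> j; rewrite finset.in_setU1 => /orP[/eqP ->|jL]; rewrite evD.
    by rewrite vi mulr1 subrr.
  by rewrite (xL' j jL) (vL j jL) mulr0 addr0.
have [|N NE] := Lub_flat zF; first by rewrite rkE; lia.
have cN : codim N = (codim L).+1 by rewrite /codim NE (rk_hyps_of_flat zF).
exists N; split.
- by apply/Lub_leP; rewrite NE [X in _ `<=` X]LE; apply: flatS; exact: finset.subsetUr.
- apply/Lub_leP; rewrite NE => y yM j; rewrite finset.in_setU1 => /orP[/eqP ->|jL].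
    by apply/hypE; exact: ((in_hyps_of _ _).1 iM).
  by apply/hypE; apply: ((in_hyps_of _ _).1 jL); move/Lub_leP: LM; exact.
- by apply/eqP => NL; move: cN; rewrite NL; lia.
- by apply/eqP => NM; move: cN; rewrite NM; lia.
Qed.

Lemma Lub_space : exists L, codim L = 0%N /\ forall M, Lub_le L M.
Proof.
have h0 : flat finset.set0 0 by move=> i; rewrite inE.
have r0 : rk finset.set0 = 0%N by rewrite /normals_rank /normals big_set0 mxrank0.
have [|L LE] := Lub_flat h0; first by rewrite r0 dim_gt0.
exists L; split; first by rewrite /codim LE (rk_hyps_of_flat h0).
by move=> M; apply/Lub_leP; rewrite LE => x _ i; rewrite inE.
Qed.

Lemma Lub_empty : exists L, [/\ val L = set0, codim L = n & forall M, Lub_le M L].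
Proof.
have E : set0 = flat finset.setT.
  apply/seteqP; split=> // x xT; rewrite -nc => i _.
  by apply/hypE/xT; rewrite inE.
have [||L LE] := @Lub_ex set0.
- by apply/lattice_flat; exists finset.setT.
- by move=> [p /seteqP[_ /(_ p erefl)]].
exists L; split=> //; last by move=> M; apply/Lub_leP; rewrite LE.
rewrite /codim LE -[RHS](rk_setT ess); congr rk; apply/setP => i.
by rewrite [RHS]inE; apply/in_hyps_of.
Qed.

End Lattice.

(** * The poset of unbounded faces *)

Section UnboundedFaces.
Local Open Scope classical_set_scope.
Variables (R : realType) (n : nat) (A : arrangement R n).
Hypothesis ess : essential A.
Hypothesis nc : noncentral A.
Let m := size_arr A.
Local Notation V := 'rV[R]_n.
Local Notation ev := (@affine_form R n A).
Local Notation cell s := (@sign_cell R n A finset.setT s).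
Local Notation zeros := (@zero_indices R n A finset.setT).
Local Notation realized := (@nonempty_cell R n A finset.setT).
Local Notation bounded := (@bounded_cell R n A finset.setT).
Local Notation rk := (@normals_rank R n A).
Implicit Types (s t : {ffun 'I_m -> option bool}) (F G : unbounded_face A).
Implicit Types (L M : Lub A).

Lemma face_ofE x : face_of A x = [set y | cell (sign_vector A x) y].
Proof.
apply/seteqP; split=> y /= h i.
  by move=> _; rewrite ffunE; apply/rsgP; rewrite /affine_form h.
by apply/rsgP; have := h i (finset.in_setT _); rewrite ffunE.
Qed.

Lemma finite_unbounded_face :
  finite_set [set F | range (face_of A) F /\ ~ bounded_set F].
Proof.
apply: (@sub_finite_set _ _
  ((fun s => [set y | cell s y]) @` [set: {ffun 'I_m -> option bool}])).
  by move=> F [[x _ <-] _]; exists (sign_vector A x); rewrite ?face_ofE.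
by apply: finite_image; exact: finite_finset.
Qed.

Lemma face_sign_ex F : exists s,
  [/\ val F = [set y | cell s y], realized s & ~ bounded s].
Proof.
have [[x _ Fx] Fu] := fset_set_valP finite_unbounded_face F.
exists (sign_vector A x); rewrite -face_ofE Fx; split=> //.
  exact: realized_sign_vector.
have xs : cell (sign_vector A x) x by apply/cell_sign_vector.
by move/(bounded_cellP ess xs); rewrite -face_ofE Fx.
Qed.

Definition face_sign F := projT1 (cid (face_sign_ex F)).

Lemma face_signP F : [/\ val F = [set y | cell (face_sign F) y],
  realized (face_sign F) & ~ bounded (face_sign F)].
Proof. exact: projT2 (cid (face_sign_ex F)). Qed.

Lemma face_realized F : realized (face_sign F). Proof. by case: (face_signP F). Qed.

Lemma face_unbounded F : ~ bounded (face_sign F).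
Proof. by case: (face_signP F). Qed.

Lemma face_sign_inj : injective face_sign.
Proof.
move=> F G FG; apply: val_inj.
by have [-> _ _] := face_signP F; have [-> _ _] := face_signP G; rewrite FG.
Qed.

Lemma face_sign_surj s : realized s -> ~ bounded s -> exists F, face_sign F = s.
Proof.
move=> [x xs] sb.
have [|F FE] := fset_set_ex finite_unbounded_face (y := face_of A x).
  split; first by exists x.
  rewrite face_ofE; have /cell_sign_vector -> := xs.
  by move/(bounded_cellP ess xs).
exists F; have [FE' _ _] := face_signP F.
have : val F x by rewrite FE face_ofE; apply/cell_sign_vector.
by rewrite FE' /= => /cell_sign_vector <-; apply/cell_sign_vector.
Qed.

Lemma unbounded_face_leP F G :
  unbounded_face_le F G = sgn_le (face_sign F) (face_sign G).
Proof.
have [x xs] := face_realized F; have [y yt] := face_realized G.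
rewrite /unbounded_face_le; have [-> _ _] := face_signP F.
have [-> _ _] := face_signP G.
by apply/asboolP/idP => /(closure_cell xs yt).
Qed.

Lemma sum_faces (W : nmodType) (P : pred {ffun 'I_m -> option bool}) (f : _ -> W) :
  \sum_(F : unbounded_face A | P (face_sign F)) f (face_sign F) =
  \sum_(s | `[< realized s /\ ~ bounded s >] && P s) f s.
Proof.
pose D : {set unbounded_face A} := finset (fun F => P (face_sign F)).
transitivity (\sum_(F in D) f (face_sign F)).
  by apply: eq_bigl => F; rewrite inE.
rewrite -(big_imset f) /=; last by move=> F G _ _; exact: face_sign_inj.
apply: eq_bigl => s; apply/imsetP/andP => [[F FD ->]|[/asboolP[sr sb] Ps]].
  rewrite inE in FD; split=> //; apply/asboolP; split.
    exact: face_realized.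
  exact: face_unbounded.
by have [F FE] := face_sign_surj sr sb; exists F; rewrite ?inE FE.
Qed.

Definition codim_face F : nat := rk (zeros (face_sign F)).

Lemma codim_face_lt F : (codim_face F < n)%N.
Proof.
rewrite ltn_neqAle rk_le andbT; apply/eqP => rkE.
apply: (@face_unbounded F) => v vF i _.
apply: (@normals_dot0 _ _ A (zeros (face_sign F))).
  by apply: submx_full; rewrite /row_full; apply/eqP.
move=> j; rewrite in_zeros => /eqP js.
by have := vF j (finset.in_setT _); rewrite js weak_sign_none => /eqP.
Qed.

(** An unbounded face has dimension between 1 and n, which leaves 0 and n + 1 for the adjoined
    elements. *)
Definition dim_Tub (x : Tub A) : nat :=
  match x with
  | inl (inl _) => 0
  | inl (inr F) => n - codim_face F
  | inr _ => n.+1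
  end.

Let bot : Tub A := inl (inl tt).
Let top : Tub A := inr tt.

Lemma Tub_le_refl : reflexive (@Tub_le R n A).
Proof. by move=> [[[]|F]|[]] //=; rewrite /Tub_le /= unbounded_face_leP sgn_le_refl. Qed.

Lemma Tub_le_trans : transitive (@Tub_le R n A).
Proof.
move=> [[[]|F]|[]] [[[]|G]|[]] [[[]|H]|[]] //=.
by rewrite /Tub_le /= !unbounded_face_leP; exact: sgn_le_trans.
Qed.

Lemma face_inl_eq F G : (inl (inr F) == inl (inr G) :> Tub A) = (F == G).
Proof. by apply/eqP/eqP => [[]|->]. Qed.

Lemma dim_Tub_lt (x y : Tub A) : Tub_le x y -> x != y -> (dim_Tub x < dim_Tub y)%N.
Proof.
case: x y => [[[]|F]|[]] [[[]|G]|[]] //=.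
- by have := codim_face_lt G; lia.
- rewrite /Tub_le /= unbounded_face_leP face_inl_eq => FG neq.
  have : (codim_face G < codim_face F)%N.
    apply: sgn_lt_rk => //; [exact: face_realized|exact: face_realized|].
    by apply: contra neq => /eqP/face_sign_inj ->.
  by have := codim_face_lt F; lia.
- by move=> _ _; lia.
Qed.

Lemma Tub_between (x y : Tub A) : Tub_le x y -> (dim_Tub x + 2 <= dim_Tub y)%N ->
  exists z, [/\ Tub_le x z, Tub_le z y, z != x & z != y].
Proof.
case: x y => [[[]|F]|[]] [[[]|G]|[]] //=; try by move=> _; lia.
- move=> _ gap; have [|||s [sr sb sG neq]] := @unbounded_below _ _ A ess (face_sign G).
  + exact: face_realized.
  + exact: face_unbounded.
  + by have := codim_face_lt G; rewrite /codim_face in gap *; lia.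
  have [F FE] := face_sign_surj sr sb.
  exists (inl (inr F)); split=> //; first by rewrite /Tub_le /= unbounded_face_leP FE.
  by rewrite face_inl_eq; apply: contra neq => /eqP <-; rewrite FE.
- move=> _ _; have [s [sr sb]] := ex_unbounded ess (dim_gt0 nc).
  by have [F _] := face_sign_surj sr sb; exists (inl (inr F)).
- rewrite /Tub_le /= unbounded_face_leP => FG gap.
  have [||||s [sr Fs sG nF nG]] := @sgn_between _ _ A (face_sign F) (face_sign G).
  + exact: face_realized.
  + exact: face_realized.
  + by [].
  + have := codim_face_lt G; have := codim_face_lt F.
    by rewrite /codim_face in gap *; lia.
  have [H HE] := face_sign_surj sr (sgn_le_unbounded Fs (@face_unbounded F)).
  exists (inl (inr H)); rewrite /Tub_le /= !unbounded_face_leP HE !face_inl_eq.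
  split=> //.
    by apply: contra nF => /eqP <-; rewrite HE.
  by apply: contra nG => /eqP <-; rewrite HE.
- move=> _ gap; have [||s [sr Fs nF]] := @sgn_bump _ _ A (face_sign F).
  + exact: face_realized.
  + by have := codim_face_lt F; rewrite /codim_face in gap *; lia.
  have [H HE] := face_sign_surj sr (sgn_le_unbounded Fs (@face_unbounded F)).
  exists (inl (inr H)); split=> //.
    by rewrite /Tub_le /= unbounded_face_leP HE.
  by rewrite face_inl_eq; apply: contra nF => /eqP <-; rewrite HE.
Qed.

Lemma rank_Tub (x : Tub A) : rank (@Tub_le R n A) x = dim_Tub x.
Proof.
apply: (@rankE _ _ _ bot) => //.
- exact: Tub_le_trans.
- exact: Tub_le_refl.
- exact: dim_Tub_lt.
- exact: Tub_between.
Qed.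

Lemma nranks_Tub : nranks (@Tub_le R n A) = n.
Proof.
rewrite /nranks; suff -> : (\max_x rank (@Tub_le R n A) x)%N = n.+1 by [].
apply/eqP; rewrite eqn_leq; apply/andP; split.
  apply/bigmax_leqP => x _; rewrite rank_Tub.
  by case: x => [[[]|F]|[]] //=; lia.
by rewrite -[X in (X <= _)%N](rank_Tub top); exact: leq_bigmax.
Qed.

Lemma rank_Lub L : rank (@Lub_le R n A) L = codim L.
Proof.
have [B [B0 Bmin]] := Lub_space ess nc.
apply: (@rankE _ _ _ B) => //.
- exact: Lub_le_trans.
- exact: Lub_le_refl.
- exact: codim_lt.
- exact: Lub_between.
Qed.

Lemma nranks_Lub : nranks (@Lub_le R n A) = n.-1.
Proof.
rewrite /nranks; suff -> : (\max_x rank (@Lub_le R n A) x)%N = n by [].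
have [E [_ En _]] := Lub_empty ess nc.
apply/eqP; rewrite eqn_leq; apply/andP; split.
  by apply/bigmax_leqP => x _; rewrite rank_Lub; exact: codim_le.
by rewrite -[X in (X <= _)%N]En -(rank_Lub E); exact: leq_bigmax.
Qed.

End UnboundedFaces.

(** * Affine spans of faces and the Euler relations between the two posets *)

Section Spans.
Variables (R : realType) (n : nat) (A : arrangement R n).
Hypothesis ess : essential A.
Hypothesis nc : noncentral A.
Local Notation zeros := (@zero_indices R n A finset.setT).
Local Notation realized := (@nonempty_cell R n A finset.setT).
Local Notation bounded := (@bounded_cell R n A finset.setT).
Local Notation rk := (@normals_rank R n A).
Local Notation sgn_of := (@face_sign R n A ess).
Implicit Types (F G : unbounded_face A) (L M : Lub A).

(** The affine span of F is the flat cut out by the hyperplanes containing F; it is not a point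
    because F is unbounded. *)
Lemma face_span_ex F : exists L : Lub A, hyps_of A (val L) = zeros (sgn_of F).
Proof.
have [x xs] := face_realized ess F.
have xF : flat (zeros (sgn_of F)) x.
  by move=> i iz; exact: cell_zeros xs iz.
have [|L LE] := Lub_flat ess xF; first exact: codim_face_lt.
exists L; rewrite LE; apply/eqP; rewrite finset.eqEsubset sub_hyps_of_flat andbT.
apply/fintype.subsetP => i /in_hyps_of/(_ x xF)/hypE xi.
by rewrite in_zeros -(xs i (finset.in_setT _)) xi /rsg eqxx.
Qed.

Definition face_span F : Lub A := projT1 (cid (face_span_ex F)).

Lemma hyps_of_face_span F : hyps_of A (val (face_span F)) = zeros (sgn_of F).
Proof. exact: projT2 (cid (face_span_ex F)). Qed.

Definition empty_flat : Lub A := projT1 (cid (Lub_empty ess nc)).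
Lemma empty_flatP : [/\ val empty_flat = classical_sets.set0,
  codim empty_flat = n & forall M, Lub_le M empty_flat].
Proof. exact: projT2 (cid (Lub_empty ess nc)). Qed.

(** The maximum, of dimension n + 1, falls in the default branch; the lemmas on [span_Tub] are
    restricted to dimension at most n. *)
Definition span_Tub (x : Tub A) : Lub A :=
  if x is inl (inr F) then face_span F else empty_flat.

Definition Lub_ge : rel (Lub A) := fun L M => Lub_le M L.
Definition dim_Lub L : nat := n - codim L.
Local Notation dT := (dim_Tub ess).

Lemma Lub_ge_refl : reflexive Lub_ge. Proof. by move=> L; exact: Lub_le_refl. Qed.

Lemma Lub_ge_trans : transitive Lub_ge.
Proof. by move=> M L N h1 h2; exact: Lub_le_trans h2 h1. Qed.

Lemma dim_Lub_lt L M : Lub_ge L M -> L != M -> (dim_Lub L < dim_Lub M)%N.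
Proof.
move=> LM; rewrite eq_sym => /(codim_lt ess LM) h; rewrite /dim_Lub.
by have := codim_le L; lia.
Qed.

Lemma dim_span x : (dT x <= n)%N -> dim_Lub (span_Tub x) = dT x.
Proof.
case: x => [[[]|F]|[]] //=; last by rewrite ltnn.
  by move=> _; have [_ En _] := empty_flatP; rewrite /dim_Lub En subnn.
by move=> _; rewrite /dim_Lub /codim hyps_of_face_span.
Qed.

Lemma Lub_ge_span F L :
  Lub_ge (face_span F) L = (hyps_of A (val L) \subset zeros (sgn_of F)).
Proof. by rewrite /Lub_ge -hyps_of_face_span; apply/idP/idP => /Lub_le_hyps. Qed.

Lemma span_le x y : (dT y <= n)%N -> Tub_le x y -> Lub_ge (span_Tub x) (span_Tub y).
Proof.
have [_ _ Emax] := empty_flatP.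
case: x y => [[[]|F]|[]] [[[]|G]|[]] //=; rewrite ?ltnn // => _;
  try by move=> _; exact: Emax.
rewrite /Tub_le /= (unbounded_face_leP ess) => /sgn_le_zeros h.
by rewrite Lub_ge_span hyps_of_face_span.
Qed.

Lemma sum_Tub (W : nmodType) (P : pred (Tub A)) (f : Tub A -> W) :
  (forall z, P z -> exists G, z = inl (inr G)) ->
  \sum_(z | P z) f z = \sum_(G : unbounded_face A | P (inl (inr G))) f (inl (inr G)).
Proof.
move=> PF; pose D : {set unbounded_face A} := finset (fun G => P (inl (inr G))).
pose h (G : unbounded_face A) : Tub A := inl (inr G).
transitivity (\sum_(G in D) f (h G)); last by apply: eq_bigl => G; rewrite inE.
rewrite -(@big_imset _ _ _ _ _ h D f) /=; last by move=> F G _ _ [].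
apply: eq_bigl => z; apply/idP/imsetP => [Pz|[G GD ->]]; last by rewrite inE in GD.
by have [G zG] := PF z Pz; exists G => //; rewrite inE -zG.
Qed.

Lemma sgn_dim F : (-1) ^+ dT (inl (inr F)) = (-1) ^+ (n + codim_face ess F) :> int.
Proof.
rewrite /= -signr_odd -[RHS]signr_odd oddB ?oddD //.
by rewrite ltnW // codim_face_lt.
Qed.

Lemma sgn_dim_Lub L : (-1) ^+ dim_Lub L = (-1) ^+ (n + codim L) :> int.
Proof. by rewrite -signr_odd -[RHS]signr_odd oddB ?oddD // codim_le. Qed.

(** From the minimum this is [euler_unbounded]. From a face F it is [euler_local]: every face above
    F is unbounded too, and the term of F itself is moved to the right-hand side. *)
Lemma euler_Tub x y : (dT x <= n)%N -> Lub_ge (span_Tub x) y ->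
  \sum_(z in above (@Tub_le R n A) dT n x | Lub_ge (span_Tub z) y) (-1) ^+ dT z =
  (-1) ^+ dim_Lub y - (-1) ^+ dT x :> int.
Proof.
move=> xn xy; rewrite sum_Tub; last first.
  move=> [[[]|G]|[]]; rewrite inE.
  - by case: x {xn xy} => [[[]|F]|[]].
  - by exists G.
  - by rewrite /= ltnn !andbF.
under eq_bigr do rewrite sgn_dim.
have dn G : (dT (inl (inr G)) <= n)%N by rewrite leq_subr.
rewrite sgn_dim_Lub; case: x xn xy => [[[]|F]|[]] xn xy; last by rewrite /= ltnn in xn.
- under eq_bigl => G do rewrite inE dn /= Lub_ge_span.
  rewrite (@sum_faces _ _ _ ess _ (fun s => hyps_of A (val y) \subset zeros s)
    (fun s => (-1) ^+ (n + rk (zeros s)))).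
  have [[p py]|y0] := EM (classical_sets.nonempty (val y)).
    rewrite (@euler_unbounded _ _ _ ess _ p) // => i iy.
    by apply/hypE; exact: (in_hyps_of _ _).1 iy p py.
  (* For the empty flat both sides are 0: a sign vector with all entries zero has no unbounded
     cell. *)
  have cy : codim y = n.
    apply/eqP; rewrite eqn_leq codim_le leqNgt; apply/negP => /(codim_lt_nonempty ess).
    exact: y0.
  have -> : hyps_of A (val y) = finset.setT.
    by apply/setP => i; rewrite [RHS]inE; apply/in_hyps_of => p py; case: y0; exists p.
  rewrite cy addnn -mul2n exprM sqrrN !expr1n subrr big1 // => s.
  move=> /andP[/asboolP[sr sb] /fintype.subsetP sT]; case: sb => v vs i iT.
  by have := vs i iT; have := sT i iT; rewrite in_zeros => /eqP ->;
    rewrite weak_sign_none => /eqP.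
- rewrite /= Lub_ge_span in xy.
  have -> : (-1) ^+ dT (inl (inr F)) = (-1) ^+ (n + rk (zeros (sgn_of F))) :> int.
    exact: sgn_dim.
  rewrite !exprD -mulrBr; under eq_bigr do rewrite exprD.
  rewrite -mulr_sumr; congr (_ * _).
  rewrite /codim -(euler_local (face_realized ess F) xy).
  apply/eqP; rewrite -subr_eq opprK eq_sym; apply/eqP.
  pose P s := sgn_le (sgn_of F) s && (hyps_of A (val y) \subset zeros s).
  transitivity (\sum_(s | `[< realized s /\ ~ bounded s >] && P s)
    (-1) ^+ rk (zeros s) : int).
    apply: eq_bigl => s; rewrite -andbA; apply/andP/andP => -[/asboolP h Ps]; split=> //;
      apply/asboolP; last by case: h.
    split=> //; move: Ps => /andP[Fs _].
    exact: sgn_le_unbounded Fs (@face_unbounded _ _ _ ess F).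
  rewrite -(sum_faces ess P (fun s => (-1) ^+ rk (zeros s))) (bigD1 F) /=; last first.
    by rewrite /P sgn_le_refl.
  rewrite addrC; congr (_ + _); apply: eq_bigl => G.
  rewrite inE dn /P /Tub_le /= (unbounded_face_leP ess) Lub_ge_span face_inl_eq andbT.
  by rewrite andbAC.
Qed.

(** * The ab-indices of both posets as chain sums *)

Lemma rev_index_iota r : rev (index_iota 0 r) = [seq (r - i.+1)%N | i <- index_iota 0 r].
Proof.
rewrite /index_iota subn0; apply: (@eq_from_nth _ 0%N).
  by rewrite size_rev size_map.
move=> i; rewrite size_rev size_iota => ir.
rewrite nth_rev ?size_iota // (nth_map 0%N) ?size_iota //.
by rewrite !nth_iota //; lia.
Qed.

Lemma star_chain_weight (C : {set Lub A}) :
  star (chain_weight pb pe (rank (@Lub_le R n A)) 0 n.-1 C) =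
  chain_weight pb pe dim_Lub 0 n.-1 C.
Proof.
rewrite /chain_weight star_prod rev_index_iota big_map.
apply: eq_big_nat => i /andP[_ ir].
have -> : [exists x in C, rank (@Lub_le R n A) x == (n.-1 - i.+1).+1] =
    [exists x in C, dim_Lub x == i.+1].
  apply: eq_existsb => L; congr (_ && _); rewrite rank_Lub // /dim_Lub.
  by have := codim_le L; have := dim_gt0 nc; lia.
by case: ifP => _; [exact: star_pb|exact: star_pe].
Qed.

(** Reversing words exchanges codimension k and dimension n - k. The chains of proper ranks in L_ub
    are those above the empty flat for inclusion, with dimensions at most n - 1, so that the whole
    space is left out. *)
Lemma star_Psi_Lub :
  star (Psi (@Lub_le R n A)) = chain_sum pb pe Lub_ge dim_Lub n.-1 empty_flat.
Proof.
have [_ En Emax] := empty_flatP.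
have dE : dim_Lub empty_flat = 0%N by rewrite /dim_Lub En subnn.
rewrite Psi_chain_sum raddf_sum /chain_sum dE (nranks_Lub ess nc).
apply: eq_big => [C|C _]; last exact: star_chain_weight.
congr (_ && _).
  apply/forall_inP/forall_inP => h x xC; apply/forall_inP => y yC;
  by have /forall_inP/(_ y yC) := h x xC; rewrite orbC.
apply/forall_inP/fintype.subsetP => h L /h; rewrite inE rank_Lub // /Lub_ge Emax /=.
  move=> /andP[L0 Ln]; rewrite /dim_Lub.
  have -> : L != empty_flat.
    by apply: contraTneq Ln => ->; rewrite En; have := dim_gt0 nc; lia.
  by have := dim_gt0 nc; lia.
move=> /andP[LE Ln]; have := codim_lt ess (Emax L) LE; rewrite En.
by rewrite /dim_Lub in Ln; have := codim_le L; have := dim_gt0 nc; lia.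
Qed.

Lemma Psi_Tub :
  Psi (@Tub_le R n A) = chain_sum pb pe (@Tub_le R n A) dT n (inl (inl tt)).
Proof.
rewrite Psi_chain_sum (nranks_Tub ess nc) /chain_sum /=.
apply: eq_big => [C|C _]; last first.
  rewrite /chain_weight; apply: eq_big_nat => i _.
  congr (if _ then _ else _); apply: eq_existsb => x.
  by rewrite (rank_Tub ess nc).
congr (_ && _).
apply/forall_inP/fintype.subsetP => h x /h; rewrite inE (rank_Tub ess nc).
  case: x {h} => [[[]|F]|[]] //=; first by move=> /andP[_ ->].
case: x {h} => [[[]|F]|[]] //= ->; rewrite andbT subn_gt0; exact: codim_face_lt.
Qed.

End Spans.

Theorem theorem1p44 (R : realType) (n : nat) (A : arrangement R n)
    (Aess : essential A) (Anc : noncentral A) :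
  Psi (Tub_le (A := A)) = star (omega (pa * Psi (Lub_le (A := A)))).
Proof.
have [B [B0 Bmax]] := Lub_space Aess Anc.
have n0 := dim_gt0 Anc.
(* The factor [pe + pb], equal to a, readmits the whole space B as an optional top element of the
   chains. *)
pose Xi (L : Lub A) : abpoly := if L == B then 1 else
  chain_sum pb pe (@Lub_ge R n A) (@dim_Lub R n A) n.-1 L * (pe + pb).
have peb : pe + pb = pa by rewrite /pe subrK.
have dB : dim_Lub B = n by rewrite /dim_Lub B0 subn0.
have [_ En Emax] := empty_flatP Aess Anc.
have XiE L : Xi L = pe ^+ (n - dim_Lub L) + \sum_(M | Lub_ge L M && (M != L))
    pe ^+ (dim_Lub M - dim_Lub L - 1) * (pb * Xi M).
  have := @chain_sum_top _ pb pe _ _ _ (@Lub_ge_refl R n A) (@Lub_ge_trans R n A)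
    (@dim_Lub_lt R n A Aess) n.-1 B L Bmax.
  by rewrite prednK // dB => /(_ erefl).
(* [star] reverses products, so a passes to the right of the reversed index. The empty flat differs
   from B since n is positive, which selects the second branch of [Xi]. *)
have -> : star (omega (pa * Psi (Lub_le (A := A)))) = romega (Xi (empty_flat Aess Anc)).
  rewrite /romega /Xi ifN; last by apply/eqP => EB; move: En; rewrite EB B0; lia.
  rewrite peb -(star_Psi_Lub Aess Anc) starM starK; congr (star (omega _)).
  by rewrite star_pa.
rewrite (Psi_Tub Aess Anc).
have dbot : (dim_Tub Aess (inl (inl tt)) <= n)%N by [].
have top_max L : Lub_ge L B by exact: Bmax.
have eeE : pe * pe = pc * pc - pd *+ 2 by exact: sqr_sub_noncomm.
have := @chain_sum_Om abpoly pa pb (pd *+ 2) romega eeE romega1 romega_b romega_aM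
  romega_baM romega_bbM n _ (@Lub_ge R n A) (@dim_Lub R n A) Xi
  (@Lub_ge_refl R n A) (@Lub_ge_trans R n A) (@dim_Lub_lt R n A Aess) XiE
  _ (@Tub_le R n A) (dim_Tub Aess) (span_Tub Aess Anc) B (@Tub_le_refl R n A Aess)
  (@Tub_le_trans R n A Aess) (@dim_Tub_lt R n A Aess) (@dim_span R n A Aess Anc)
  (@span_le R n A Aess Anc) top_max dB
  (@euler_Tub R n A Aess Anc) abpoly_double_inj _ dbot.
exact: id.
Qed.
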